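(* Every triangulation $G$ of the projective plane has a weak or near-weak $2$-coloring.
   Context: A triangulation of a surface is a graph without loops or multiple edges, 2-cell embedded on the surface such that every face is bounded by a closed walk of length 3. A 2-coloring of $G$ is a (not necessarily proper) map $c:V(G)\to\{B,W\}$. A face is monochromatic under $c$ if all its vertices receive the same color. The coloring $c$ is weak if no face is monochromatic, and near-weak if exactly one face is monochromatic. *)

(* Defs.v *)
From mathcomp Require Import all_boot.
Set Implicit Arguments. Unset Strict Implicit. Unset Printing Implicit Defensive.

Section Tri.
Variables (T : finType) (F : {set {set T}}).

Definition tri_edges : {set {set T}} :=
  [set e : {set T} | (#|e| == 2) && [exists f in F, e \subset f]].

Definition tri_adj : rel T :=
  fun x y => (x != y) && [exists f in F, (x \in f) && (y \in f)].

Definition tri_link (v : T) : rel T :=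
  fun a b => [&& a != v, b != v, a != b & [set v; a; b] \in F].

(* F is the face set of a triangulation (simple graph, 2-cell embedded,
   triangular faces) of the projective plane: a closed connected combinatorial
   surface of Euler characteristic 1. *)
Definition is_projplane_triangulation : Prop :=
  (forall f, f \in F -> #|f| = 3) /\
  (forall v : T, exists2 f, f \in F & v \in f) /\
  (forall e, e \in tri_edges -> #|[set f in F | e \subset f]| = 2) /\
  (forall v a b, tri_adj v a -> tri_adj v b -> connect (tri_link v) a b) /\
  (forall x y : T, connect tri_adj x y) /\
  #|T| + #|F| = #|tri_edges| + 1.

Definition monochromatic (c : T -> bool) (f : {set T}) : bool :=
  [forall x in f, forall y in f, c x == c y].

Definition n_mono (c : T -> bool) : nat := #|[set f in F | monochromatic c f]|.

Definition weak_coloring (c : T -> bool) : Prop := n_mono c = 0.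
Definition near_weak_coloring (c : T -> bool) : Prop := n_mono c = 1.

End Tri.

(* Main.v *)
Require Import Defs.
From mathcomp Require Import all_boot.
From mathcomp Require Import all_algebra.
From mathcomp Require Import zify.
Set Implicit Arguments. Unset Strict Implicit. Unset Printing Implicit Defensive.

(* Let H be the dual cubic graph. A coloring is weak (near-weak) if and only if
   the bichromatic edges form a 2-factor of H (of H minus one vertex), and an even
   subgraph of H consists of the bichromatic edges of some coloring if and only if
   it is null-homologous mod 2. By Euler's formula this amounts to the vanishing
   of a single linear functional, given by edge weights phi : E -> F_2.

   As the triangulation has no loops, H is bridgeless, so by Tutte's theorem
   every edge of H lies in a perfect matching. Fix a perfect matching M, and call a blossom an odd
   cycle that alternates with respect to M except at one vertex. Adding an
   alternating cycle or a blossom mod 2 to the 2-factor H - M yields a 2-factor,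
   or a 2-factor missing one vertex. So it is enough to show that if phi vanishes
   on all alternating cycles and blossoms, then it vanishes on H - M. To this end,
   grow an M-saturated set U with a potential p such that any two vertices a, b
   of U are joined in U by a path of weight p a + p b, which every alternating ear
   between a and b closes to an alternating cycle or a blossom. A further ear
   then has the weight prescribed by p, and this property extends to its
   vertices; ears exist as long as U is not everything, because every edge lies
   in a perfect matching. Thus phi is the coboundary of p on H - M, which has even
   degrees. *)

(** * Matchings and the Tutte-Berge certificate *)

(** The points of [D] that [f] moves fall into pairs [x], [f x]; the induction removes one such
    pair. *)
Lemma odd_card_involution (V : finType) (f : V -> V) (D : {set V}) :
  involutive f -> (forall x, x \in D -> f x \in D) ->
  odd #|D| = odd #|[set x in D | f x == x]|.
Proof.
move=> fK; have [n] := ubnP #|D|; elim: n D => // n IH D leDn stD.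
have [/exists_inP[x xD fx]|/exists_inPn fixD] := boolP [exists x in D, f x != x]; last first.
  congr (odd #|pred_of_set _|); apply/setP=> x; rewrite inE.
  by case xD: (x \in D) => //=; have := fixD x xD; rewrite negbK => ->.
have fxD : f x \in D :\ x by rewrite !inE fx stD.
rewrite (cardsD1 x) xD (cardsD1 (f x)) fxD /= negbK (IH (D :\ x :\ f x)).
- congr (odd #|pred_of_set _|); apply/setP=> y; rewrite !inE.
  have [->|ny] := eqVneq y x; first by rewrite (negbTE fx) !andbF.
  have [->|//] := eqVneq y (f x).
  by rewrite fK [x == _]eq_sym (negbTE fx) !andbF.
- by move: leDn; rewrite (cardsD1 x D) xD (cardsD1 (f x) (D :\ x)) fxD !add1n !ltnS; exact: ltnW.
- move=> y; rewrite !inE => /and3P[yfx yx yD]; rewrite stD // andbT.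
  apply/andP; split; first by apply: contra yx => /eqP /(can_inj fK)->.
  by apply: contra yfx => /eqP <-; rewrite fK.
Qed.

Section Matchings.
Variables (V : finType) (e : rel V).
Hypothesis e_sym : symmetric e.

(** A matching is encoded as an involution: its fixed points are the uncovered vertices, among them
    every vertex outside [A]. *)
Definition matching (A : {set V}) (m : {ffun V -> V}) :=
  [forall x, (m (m x) == x) && ((m x != x) ==> (x \in A) && e x (m x))].

Definition uncovered (A : {set V}) (m : V -> V) := [set x in A | m x == x].

Lemma matchingP (A : {set V}) (m : {ffun V -> V}) :
  reflect (involutive m /\ forall x, m x != x -> x \in A /\ e x (m x))
          (matching A m).
Proof.
apply: (iffP forallP) => [H|[mK mA] x].
  split=> x; first by have /andP[/eqP] := H x.
  by have /andP[_ /implyP mx] := H x => /mx /andP.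
by rewrite mK eqxx; apply/implyP => /mA[-> ->].
Qed.

Lemma matching_closed (A : {set V}) (m : {ffun V -> V}) x :
  matching A m -> x \in A -> m x \in A.
Proof.
move/matchingP=> [mK mA] xA; have [->//|mx] := eqVneq (m x) x.
by have [] := mA (m x); rewrite // mK eq_sym.
Qed.

Lemma odd_uncovered (A : {set V}) (m : {ffun V -> V}) :
  matching A m -> odd #|uncovered A m| = odd #|A|.
Proof.
move=> mA; have [mK _] := matchingP _ _ mA.
rewrite -odd_card_involution // => x; exact: matching_closed.
Qed.

(** For an uncovered [x], this adds the edge from [x] to [y] and drops the old edge at [y], so that
    the former partner [m y] becomes uncovered. *)
Definition rematch (m : {ffun V -> V}) x y : {ffun V -> V} :=
  [ffun u => if u == x then y else if u == y then x
             else if u == m y then u else m u].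

Lemma matching_rematch (A : {set V}) (m : {ffun V -> V}) x y :
  matching A m -> m x = x -> x != y -> x \in A -> y \in A -> e x y ->
  matching A (rematch m x y).
Proof.
move/matchingP=> [mK mA] mx xy xA yA exy; apply/matchingP; split=> u.
  rewrite !ffunE; have [->|ux] := eqVneq u x.
    by rewrite (eq_sym y) (negbTE xy) eqxx.
  have [->|uy] := eqVneq u y; first by rewrite eqxx.
  have [umy|umy] := eqVneq u (m y); first by rewrite (negbTE ux) (negbTE uy) -umy eqxx.
  by rewrite -{1}mx (can2_eq mK mK u y) !(can_eq mK) (negbTE ux) (negbTE umy) (negbTE uy) mK.
rewrite !ffunE; have [->//|ux] := eqVneq u x.
have [->|uy] := eqVneq u y; first by rewrite e_sym.
by have [->|umy] := eqVneq u (m y); rewrite ?eqxx // => /mA.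
Qed.

Lemma uncovered_rematch (A : {set V}) (m : {ffun V -> V}) x y u : x != y ->
  u \in uncovered A (rematch m x y) ->
  [/\ u \in A, u != x, u != y & (u == m y) || (m u == u)].
Proof.
move=> xy; rewrite inE ffunE => /andP[->].
have [->|ux] := eqVneq u x; first by rewrite eq_sym (negbTE xy).
have [->|uy] := eqVneq u y; first by rewrite (negbTE xy).
by have [->|umy] := eqVneq u (m y).
Qed.

Lemma matching_id (A : {set V}) : matching A [ffun x => x].
Proof. by apply/matchingP; split=> x; rewrite !ffunE ?eqxx. Qed.

Lemma matchingS (A B : {set V}) m : A \subset B -> matching A m -> matching B m.
Proof.
move=> /subsetP AB /matchingP[mK mA]; apply/matchingP; split=> // x /mA[xA exm].
by split=> //; apply: AB.
Qed.

(* In the induction for the Tutte-Berge formula, if no vertex of [A] is covered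
   by all maximum matchings, then "equal, or never missed together by a maximum
   matching" is an equivalence relation containing adjacency (Gallai); the
   classes of the vertices missed by one maximum matching form the family. *)
Section Gallai.
Variables (A : {set V}) (k : nat).
Hypothesis kmin : forall m, matching A m -> k <= #|uncovered A m|.
Let maxm m := matching A m && (#|uncovered A m| <= k).
Let R x y := (x == y) ||
  [forall m : {ffun V -> V}, maxm m ==> ~~ ((m x == x) && (m y == y))].
Hypothesis missable : forall x, x \in A -> exists2 m, maxm m & m x = x.

Let Rsym : symmetric R.
Proof.
by move=> x y; rewrite /R eq_sym; congr (_ || _); apply: eq_forallb => m; rewrite andbC.
Qed.

(** A maximum matching missing both ends of an edge could be enlarged by that edge. *)
Let R_adj x y : x \in A -> y \in A -> e x y -> R x y.
Proof.
move=> xA yA exy; rewrite /R; case: eqVneq => //= xy.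
apply/forallP => m; apply/implyP => /andP[mA mk]; apply/negP => /andP[/eqP mx /eqP my].
have := kmin (matching_rematch mA mx xy xA yA exy).
rewrite leqNgt => /negP; apply; apply: leq_trans mk; apply: proper_card.
apply/properP; split; last first.
  by exists x; rewrite !inE ?mx ?eqxx ?xA // ffunE eqxx eq_sym (negbTE xy).
apply/subsetP=> u /(uncovered_rematch xy)[uA _ uy].
by rewrite inE uA my (negbTE uy).
Qed.

(** Suppose that a maximum matching [M] misses [x] and [y]. Among the maximum matchings missing [t],
    let [N] agree with [M] on the most vertices. It covers [x] and [y], so by counting it misses two
    vertices covered by [M], one of them, [z], other than [t]. Rematching [z] to [M z] in [N] either
    enlarges [N] or yields a maximum matching that still misses [t] and agrees with [M] on more
    vertices. *)
Let R_trans x t y : x \in A -> t \in A -> y \in A -> R x t -> R t y -> R x y.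
Proof.
move=> xA tA yA; rewrite /R.
have [->//|xt /= /forallP Rxt] := eqVneq x t.
have [<-|ty /= /forallP Rty] := eqVneq t y; first by rewrite (negbTE xt) => _ /=; apply/forallP.
have [//|xy /=] := eqVneq x y.
apply/forallP => M; apply/implyP => maxM; apply/negP => /andP[/eqP Mx /eqP My].
pose agree (N : {ffun V -> V}) := #|[set u | M u == N u]|.
have [N0 maxN0 N0t] := missable tA.
have [|N /andP[maxN /eqP Nt] Nmax] :=
  @arg_maxnP _ N0 (fun N => maxm N && (N t == t)) agree; first by rewrite maxN0 N0t eqxx.
have Nx : N x != x by have := Rxt N; rewrite maxN Nt eqxx andbT.
have Ny : N y != y by have := Rty N; rewrite maxN Nt eqxx.
have [MA Mk] := andP maxM; have [NA Nk] := andP maxN.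
have [MK MA'] := matchingP _ _ MA; have [NK NA'] := matchingP _ _ NA.
have cM : #|uncovered A M| = k by apply/eqP; rewrite eqn_leq Mk kmin.
have cN : #|uncovered A N| = k by apply/eqP; rewrite eqn_leq Nk kmin.
have : 1 < #|uncovered A N :\: uncovered A M|.
  have c1 : 1 < #|uncovered A M :\: uncovered A N|.
    apply/card_gt1P; exists x, y.
    by rewrite !inE Mx My xA yA Nx Ny !eqxx.
  suff <- : #|uncovered A M :\: uncovered A N| = #|uncovered A N :\: uncovered A M| by [].
  apply/eqP; rewrite -(eqn_add2l #|uncovered A M :&: uncovered A N|).
  by rewrite cardsID setIC cardsID cM cN.
case/card_gt1P=> z1 [z2 [z1N z2N z12]].
have [z] : exists2 z, z \in uncovered A N :\: uncovered A M & z != t.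
  by have [z1t|] := eqVneq z1 t; [exists z2; rewrite // -z1t eq_sym | exists z1].
rewrite !inE => /and3P[Mz zA /eqP Nz] zt; rewrite zA /= in Mz.
have [_ ezM] := MA' z Mz.
have MzA := matching_closed MA zA.
have zMz : z != M z by rewrite eq_sym.
have N'A := matching_rematch NA Nz zMz zA MzA ezM.
set w := N (M z).
have N'z : rematch N z (M z) z = M z by rewrite ffunE eqxx.
have [wz|wMz] := eqVneq (N (M z)) (M z).
  have := kmin N'A; rewrite leqNgt => /negP; apply; rewrite -cN.
  apply: proper_card; apply/properP; split; last first.
    by exists z; rewrite !inE ?Nz ?eqxx ?zA // N'z (negbTE Mz).
  apply/subsetP=> u /(uncovered_rematch zMz)[uA _ uMz].
  by rewrite inE uA wz (negbTE uMz).
have tMz : t != M z by apply: contra wMz => /eqP <-; rewrite Nt.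
have : maxm (rematch N z (M z)) && (rematch N z (M z) t == t).
  apply/andP; split; last first.
    by rewrite ffunE [t == z]eq_sym (negbTE zt) (negbTE tMz); case: ifP; rewrite ?Nt eqxx.
  rewrite /maxm N'A /= -cN (cardsD1 z (uncovered A N)) inE zA Nz eqxx add1n.
  have sub : uncovered A (rematch N z (M z)) \subset w |: (uncovered A N :\ z).
    by apply/subsetP=> u /(uncovered_rematch zMz)[uA uz _]; rewrite !inE uA uz.
  by apply: leq_trans (subset_leq_card sub) _; rewrite cardsU1; case: (_ \notin _).
move/Nmax; rewrite /agree /= leqNgt => /negP; apply; apply: proper_card.
apply/properP; split; last first.
  by exists z; rewrite !inE ?N'z // Nz.
apply/subsetP=> u; rewrite !inE ffunE => /eqP Mu.
have [->//|uz] := eqVneq u z; have [->|uMz] := eqVneq u (M z); first by rewrite MK.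
have [uw|_] := eqVneq u (N (M z)); last by rewrite Mu.
by have /(can_inj MK) uz' : M u = M z; [rewrite Mu uw NK | rewrite uz' eqxx in uz].
Qed.

(** Adjacent vertices are equivalent, so [m] maps each class to itself; two equivalent vertices are
    never both missed, so it fixes exactly one vertex of each chosen class. Hence these classes are
    odd. *)
Lemma gallai_certificate m : maxm m -> exists P : {set {set V}},
  [/\ trivIset P,
      forall D, D \in P -> [/\ D \subset A, odd #|D| &
        forall x y, x \in D -> y \in A -> e x y -> y \in D] &
      #|P| = #|uncovered A m| ].
Proof.
move=> maxM; have [mA mk] := andP maxM; have [mK mA'] := matchingP _ _ mA.
pose cls x := [set y in A | R x y].
have cls_eq x y z : x \in A -> y \in A -> z \in cls x -> z \in cls y -> cls x = cls y.
  move=> xA yA; rewrite !inE => /andP[zA Rxz] /andP[_ Ryz].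
  have Rxy : R x y by apply: (R_trans xA zA yA Rxz); rewrite Rsym.
  apply/setP=> u; rewrite !inE; case uA: (u \in A) => //=.
  by apply/idP/idP => ?; [apply: (@R_trans y x) | apply: (@R_trans x y)]; rewrite // Rsym.
have clsx x : x \in A -> x \in cls x by rewrite inE /R eqxx => ->.
exists [set cls x | x in uncovered A m]; split.
- apply/trivIsetP=> _ _ /imsetP[x + ->] /imsetP[y + ->]; rewrite !inE.
  move=> /andP[xA _] /andP[yA _]; apply: contraNT => /pred0Pn[z /andP[zx zy]].
  by apply/eqP; apply: cls_eq zx zy.
- move=> _ /imsetP[x + ->]; rewrite inE => /andP[xA /eqP mx]; split.
  + by apply/subsetP=> y; rewrite inE => /andP[].
  + rewrite (odd_card_involution mK); last first.
      move=> y; rewrite !inE => /andP[yA Rxy]; rewrite matching_closed //.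
      have [->//|my] := eqVneq (m y) y.
      apply: (@R_trans _ y) => //; first exact: matching_closed.
      by apply: R_adj => //; [exact: matching_closed | have [] := mA' y].
    suff -> : [set y in cls x | m y == y] = [set x] by rewrite cards1.
    apply/setP=> y; rewrite !inE; apply/idP/eqP => [/andP[/andP[yA]]|->]; last first.
      by rewrite xA mx eqxx /R eqxx.
    rewrite /R => /orP[/eqP->//|/forallP/(_ m)/implyP/(_ maxM)].
    by rewrite mx eqxx /= => /negbTE->.
  move=> z y; rewrite !inE => /andP[zA Rxz] yA ezy; rewrite yA.
  by apply: (@R_trans _ z) => //; apply: R_adj.
rewrite card_in_imset // => x y; rewrite !inE => /andP[xA /eqP mx] /andP[yA /eqP my] cxy.
have : y \in cls x by rewrite cxy clsx.
rewrite inE yA /R => /orP[/eqP->//|/forallP/(_ m)/implyP/(_ maxM)].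
by rewrite mx my !eqxx.
Qed.

End Gallai.

(** Each odd set in [P] has a vertex that is uncovered or matched into [S], so [S] and [P] certify
    that [m] is maximum. If some [v] is covered by all maximum matchings, a certificate for [A :\ v]
    serves after adding [v] to [S]; otherwise Gallai's classes serve with [S] empty. *)
Lemma tutte_berge_certificate (A : {set V}) :
  exists (m : {ffun V -> V}) (S : {set V}) (P : {set {set V}}),
  [/\ matching A m, S \subset A, trivIset P,
      forall D, D \in P -> [/\ D \subset A :\: S, odd #|D| &
        forall x y, x \in D -> y \in A -> e x y -> (y \in D) || (y \in S)] &
      #|S| + #|uncovered A m| <= #|P| ].
Proof.
have [n] := ubnP #|A|; elim: n A => // n IH A leAn.
have [m0 m0A m0min] := arg_minnP (fun m : {ffun V -> V} => #|uncovered A m|) (matching_id A).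
have kmin m : matching A m -> #|uncovered A m0| <= #|uncovered A m| by exact: m0min.
pose maxm m := matching A m && (#|uncovered A m| <= #|uncovered A m0|).
have maxm0 : maxm m0 by rewrite /maxm m0A leqnn.
have [/exists_inP[v vA /forallP vcov]|/exists_inPn miss] := boolP
    [exists v in A, [forall m : {ffun V -> V}, maxm m ==> (m v != v)]].
  have [|m [S [P [mA SA tP PP cP]]]] := IH (A :\ v).
    by move: leAn; rewrite (cardsD1 v) vA; lia.
  have mA' := matchingS (subD1set A v) mA.
  have mv : m v = v.
    by apply/eqP/negP=> /negP mv; have [_ /(_ v mv)] := matchingP _ _ mA; rewrite !inE eqxx => -[].
  have cm : #|uncovered A m| = #|uncovered (A :\ v) m|.+1.
    rewrite (cardsD1 v) inE vA mv eqxx add1n; congr _.+1; apply: eq_card => u.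
    by rewrite !inE andbA.
  have km : #|uncovered A m0| < #|uncovered A m|.
    by have := vcov m; rewrite /maxm mA' mv eqxx implybF /= -ltnNge.
  (* Equal parity improves the gap of one between the two deficiencies to two, which pays for the
     new vertex of [S]. *)
  have pm : odd #|uncovered A m0| = odd #|uncovered A m| by rewrite !odd_uncovered.
  exists m0, (v |: S), P; split=> //.
  - by rewrite subUset sub1set vA (subset_trans SA) ?subD1set.
  - move=> D DP; have [DA oD De] := PP D DP; split=> //.
      by apply: subset_trans DA _; apply/subsetP=> u; rewrite !inE negb_or => /and3P[-> -> ->].
    move=> x y xD yA exy; rewrite !inE.
    have [->|yv] := eqVneq y v; first by rewrite orbT.
    by have /= := De x y xD; rewrite !inE yv; apply.
  - have vS : v \notin S by apply/negP=> /(subsetP SA); rewrite !inE eqxx.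
    move: km; rewrite cm ltnS leq_eqVlt => /orP[/eqP km|km].
      by move: pm; rewrite cm km /=; case: odd.
    by rewrite cardsU1 vS add1n addSnnS; apply: leq_trans cP; rewrite leq_add2l.
have missable x : x \in A -> exists2 m, maxm m & m x = x.
  move=> /miss; rewrite negb_forall => /existsP[m].
  by rewrite negb_imply negbK => /andP[mm /eqP mx]; exists m.
have [P [tP PP cP]] := gallai_certificate kmin missable maxm0.
exists m0, set0, P; split=> //; rewrite ?sub0set ?cards0 ?cP //.
by move=> D /PP[DA oD De]; split; rewrite ?setD0 // => x y xD yA exy; rewrite (De x y).
Qed.

End Matchings.

(** * Perfect matchings of cubic graphs *)

Definition perfect_matching (V : finType) (e : rel V) (m : V -> V) :=
  involutive m /\ forall x, e x (m x).

(** If deleting [u] and [v] leaves no perfect matching, parity gives at least two uncovered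
    vertices, so [#|P| >= #|S| + 2]. Every set in [P] sends at least 3 edges to [S], [u] and [v].
    These receive at most [3 * #|S| + 4], because the edge between [u] and [v] takes one of the
    three places at each of them. *)
Lemma edge_in_perfect_matching (V : finType) (e : rel V) (u v : V) :
  symmetric e -> irreflexive e -> (forall x, #|[set y | e x y]| = 3) ->
  (forall D : {set V}, odd #|D| ->
     2 < \sum_(x in D) #|[set y in ~: D | e x y]|) ->
  e u v -> exists2 m, perfect_matching e m & m u = v.
Proof.
move=> e_sym e_irr cubic cut3 euv.
have uv : u != v by apply: contraTneq euv => ->; rewrite e_irr.
have evenV : ~~ odd #|[set: V]|.
  apply/negP=> /cut3; rewrite big1 // => x _; apply: eq_card0 => y.
  by rewrite !inE.
pose A := ~: [set u; v].
have evenA : ~~ odd #|A|.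
  by move: evenV; rewrite cardsT -(cardsC [set u; v]) cards2 uv oddD.
have [m [S [P [mA SA tP PP cP]]]] := tutte_berge_certificate e_sym A.
have [mK mA'] := matchingP _ _ _ mA.
have mfix x : x \notin A -> m x = x.
  by move=> xA; apply/eqP; apply: contraNT xA => /mA'[].
have mu : m u = u by apply: mfix; rewrite !inE eqxx.
have mv : m v = v by apply: mfix; rewrite !inE eqxx orbT.
have [unc0|] := eqVneq #|uncovered A m| 0.
  have mT : matching e setT (rematch m u v).
    by apply: matching_rematch; rewrite ?inE // (matchingS _ mA) ?subsetT.
  have [rK rT] := matchingP _ _ _ mT.
  exists (rematch m u v); last by rewrite ffunE eqxx.
  split=> // x; suff rx : rematch m u v x != x by have [] := rT x rx.
  apply/negP=> rx; have /(uncovered_rematch uv)[_ xu xv] : x \in uncovered setT (rematch m u v).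
    by rewrite !inE.
  rewrite mv (negbTE xv) /= => mx; move/eqP: unc0; rewrite cards_eq0 => /eqP/setP/(_ x).
  by rewrite !inE negb_or xu xv mx.
move=> unc_n0; exfalso.
have unc2 : 1 < #|uncovered A m|.
  by move: evenA unc_n0; rewrite -(odd_uncovered mA); case: #|uncovered A m| => [|[]].
have uS : u \notin S by apply/negP=> /(subsetP SA); rewrite !inE eqxx.
have vS : v \notin S by apply/negP=> /(subsetP SA); rewrite !inE eqxx orbT.
have PA D x : D \in P -> x \in D -> x \in A.
  by move=> /PP[/subsetP DA _ _] /DA; rewrite inE => /andP[].
pose W := u |: (v |: S).
have lower : 3 * #|P| <= \sum_(D in P) \sum_(x in D) #|[set y in W | e x y]|.
  rewrite mulnC -sum_nat_const; apply: leq_sum => D DP; have [_ oD De] := PP D DP.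
  apply: leq_trans (cut3 D oD) _; apply: leq_sum => x xD; apply: subset_leq_card.
  apply/subsetP=> y; rewrite !inE => /andP[yD exy]; rewrite exy andbT.
  have [//|yu] := eqVneq y u; have [//|yv] := eqVneq y v.
  by have := De x y xD; rewrite !inE negb_or yu yv (negbTE yD); apply.
have upper : \sum_(D in P) \sum_(x in D) #|[set y in W | e x y]| <= 3 * #|S| + 4.
  rewrite -(big_trivIset _ (E := fun x => #|[set y in W | e x y]|)) //=.
  under eq_bigr => x _.
    rewrite -sum1_card (eq_bigl (fun y => (y \in W) && e x y)) => [|y]; last by rewrite inE.
    over.
  rewrite (exchange_big_dep (mem W)) /=; last by move=> x y _ /andP[].
  have degle y : \sum_(x in cover P | (y \in W) && e x y) 1 <= 3.
    rewrite sum1_card -(cubic y); apply: subset_leq_card; apply/subsetP=> x.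
    by rewrite unfold_in inE e_sym => /and3P[].
  have degle2 y z : e y z -> z \notin A -> \sum_(x in cover P | (y \in W) && e x y) 1 <= 2.
    move=> eyz zA; rewrite sum1_card -ltnS -(cubic y); apply: proper_card.
    apply/properP; split.
      by apply/subsetP=> x; rewrite unfold_in inE e_sym => /and3P[].
    exists z; first by rewrite inE.
    by apply: contra zA; rewrite unfold_in => /and3P[/bigcupP[D DP] + _ _]; exact: PA.
  have splitW F : \sum_(y in W) F y = F u + F v + \sum_(y in S) F y.
    by rewrite big_setU1 ?inE ?negb_or ?uv //= big_setU1 // addnA.
  rewrite splitW.
  have Su : \sum_(x in cover P | (u \in W) && e x u) 1 <= 2.
    by apply: degle2 euv _; rewrite !inE eqxx orbT.
  have Sv : \sum_(x in cover P | (v \in W) && e x v) 1 <= 2.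
    by apply: (@degle2 _ u); rewrite 1?e_sym // !inE eqxx.
  have SS : \sum_(y in S) \sum_(x in cover P | (y \in W) && e x y) 1 <= 3 * #|S|.
    by rewrite mulnC -sum_nat_const; apply: leq_sum => y _.
  by rewrite [3 * _ + 4]addnC; apply: leq_add SS; apply: (leq_add Su Sv).
by move: lower upper cP unc2; clear; lia.
Qed.

(** * Alternating cycles and blossoms *)

Definition graph_edges (V : finType) (e : rel V) : {set {set V}} :=
  [set [set p.1; p.2] | p in [set p : V * V | e p.1 p.2]].

Lemma graph_edgesP (V : finType) (e : rel V) (X : {set V}) :
  reflect (exists x y, e x y /\ X = [set x; y]) (X \in graph_edges e).
Proof.
apply: (iffP imsetP) => [[[x y]]|[x [y [exy ->]]]].
  by rewrite inE => exy ->; exists x, y.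
by exists (x, y); rewrite ?inE.
Qed.

(** The degree identities are linear in the indicators of vertices, so these may be generalized to
    arbitrary naturals. *)
Ltac indicator_lia :=
  repeat match goal with |- context [nat_of_bool ?b] => generalize (nat_of_bool b) end;
  clear; lia.

Section Alternation.
Variables (V : finType) (e : rel V) (m : V -> V) (phi : {set V} -> bool).
Hypotheses (e_sym : symmetric e) (e_irr : irreflexive e).
Hypothesis pm : perfect_matching e m.

Let mK : involutive m. Proof. by case: pm. Qed.
Let em x : e x (m x). Proof. by case: pm. Qed.
Let m_neq x : (m x == x) = false.
Proof. by apply/eqP => mx; have := em x; rewrite mx e_irr. Qed.

Definition matched (X : {set V}) := [exists x, X == [set x; m x]].

Lemma matched2 x y : matched [set x; y] = (y == m x).
Proof.
apply/existsP/eqP => [[z /eqP/setP E]|->]; last by exists x.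
have := E x; have := E y; have := E z; have := E (m z).
rewrite !inE !eqxx ?orbT /=.
move=> /orP mz /orP z_ /esym/orP y_ /esym/orP x_.
have mz' := m_neq z.
case: y_ => /eqP yz; case: x_ => /eqP xz; subst; rewrite ?mK //.
  by case: mz => /eqP mz; rewrite mz eqxx in mz'.
by case: z_ => /eqP z_; rewrite -z_ eqxx in mz'.
Qed.

(** Alternating walks enter only through their edge lists and these two degrees: alternation at a
    vertex becomes equality of the two. *)
Definition nonmatched_deg (q : seq {set V}) (v : V) :=
  count (fun X : {set V} => (v \in X) && ~~ matched X) q.
Definition matched_deg (q : seq {set V}) (v : V) :=
  count (fun X : {set V} => (v \in X) && matched X) q.
Definition weight (q : seq {set V}) := \big[addb/false]_(X <- q) phi X.

Arguments nonmatched_deg : simpl never.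
Arguments matched_deg : simpl never.

Local Notation nN := nonmatched_deg.
Local Notation nM := matched_deg.
Local Notation E := (graph_edges e).

Lemma weight_cat q1 q2 : weight (q1 ++ q2) = weight q1 (+) weight q2.
Proof. by rewrite /weight big_cat. Qed.
Lemma weight_cons X q : weight (X :: q) = phi X (+) weight q.
Proof. by rewrite /weight big_cons. Qed.
Lemma weight1 X : weight [:: X] = phi X.
Proof. by rewrite /weight big_seq1. Qed.

Lemma in_pair (x y v : V) : x != y -> (v \in [set x; y]) = (v == x) + (v == y) :> nat.
Proof.
by move=> xy; rewrite !inE; have [->|] := eqVneq v x; rewrite ?(negbTE xy).
Qed.

Lemma nN_cat q1 q2 v : nN (q1 ++ q2) v = nN q1 v + nN q2 v.
Proof. exact: count_cat. Qed.
Lemma nM_cat q1 q2 v : nM (q1 ++ q2) v = nM q1 v + nM q2 v.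
Proof. exact: count_cat. Qed.
Lemma nN0 v : nN [::] v = 0. Proof. by []. Qed.
Lemma nM0 v : nM [::] v = 0. Proof. by []. Qed.
Lemma nN_matched x q v : nN ([set x; m x] :: q) v = nN q v.
Proof. by rewrite /nN /= matched2 eqxx andbF. Qed.
Lemma nM_matched x q v : nM ([set x; m x] :: q) v = (v == x) + (v == m x) + nM q v.
Proof. by rewrite /nM /= matched2 eqxx andbT in_pair // eq_sym m_neq. Qed.
Lemma nN_nonmatched x y q v : e x y -> y != m x ->
  nN ([set x; y] :: q) v = (v == x) + (v == y) + nN q v.
Proof.
move=> exy yx; rewrite /nN /= matched2 (negbTE yx) andbT in_pair //.
by apply: contraTneq exy => ->; rewrite e_irr.
Qed.
Lemma nM_nonmatched x y q v : y != m x -> nM ([set x; y] :: q) v = nM q v.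
Proof. by move=> yx; rewrite /nM /= matched2 (negbTE yx) andbF. Qed.

(* An alternating path m a, z1, m z1, z2, m z2, ... is coded by [a] and the
   sequence z1, z2, ...; its edges {m z_i, z_(i+1)} are unmatched. *)
Definition alt a z := e (m a) z && (z != a).

Fixpoint zigzag a s : seq {set V} :=
  if s is z :: s' then [:: [set m a; z], [set z; m z] & zigzag z s'] else [::].

(** While [zigzag] leaves [m a] by an unmatched edge, [zig] starts at [z] with its matched edge;
    [zag] prolongs [zig] by a final unmatched edge to [w]. *)
Definition zig z s := [set z; m z] :: zigzag z s.
Lemma zigzag_cons a z s : zigzag a (z :: s) = [set m a; z] :: zig z s.
Proof. by []. Qed.

Definition zag z s w := rcons (zig z s) [set m (last z s); w].

(** A vertex of [s] stands for its matched edge: [on s] is the set of ends of these edges, and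
    [simple s] makes the edges pairwise distinct. *)
Definition on (s : seq V) x := (x \in s) || (m x \in s).
Definition simple (s : seq V) := uniq s && all (fun z => m z \notin s) s.

Arguments zig : simpl never.
Arguments zag : simpl never.
Arguments on : simpl never.
Arguments simple : simpl never.

Lemma zigzag_cat a s t : zigzag a (s ++ t) = zigzag a s ++ zigzag (last a s) t.
Proof. by elim: s a => //= z s IH a; rewrite IH. Qed.

(** The walk starts at [m a] with an unmatched edge and ends at [m (last a s)] with a matched one;
    in between, the two kinds of edges alternate and cancel. *)
Lemma degree_zigzag a s v : path alt a s ->
  nN (zigzag a s) v + (v == m (last a s)) = nM (zigzag a s) v + (v == m a).
Proof.
elim: s a => [|z s IH] a //= /andP[/andP[eaz za] /IH H].
rewrite nN_nonmatched ?mK // nN_matched nM_nonmatched ?mK // nM_matched.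
move: H; indicator_lia.
Qed.

Lemma degree_zig z s v : path alt z s ->
  nN (zig z s) v + (v == z) + (v == m (last z s)) = nM (zig z s) v.
Proof. by move=> /(degree_zigzag v); rewrite nN_matched nM_matched; indicator_lia. Qed.

Lemma degree_zag z s w v : path alt z (rcons s w) ->
  nN (zag z s w) v + (v == z) = nM (zag z s w) v + (v == w).
Proof.
rewrite rcons_path => /andP[/(degree_zig v) H /andP[elw wl]].
rewrite /zag -cats1 nN_cat nM_cat nN_nonmatched ?mK // nM_nonmatched ?mK //.
by rewrite nN0 nM0; move: H; indicator_lia.
Qed.

Lemma pair_edge x y : e x y -> [set x; y] \in E.
Proof. by move=> exy; apply/graph_edgesP; exists x, y. Qed.

Lemma zigzag_edges a s : path alt a s -> {subset zigzag a s <= E}.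
Proof.
elim: s a => [|z s IH] a //= /andP[/andP[eaz za] /IH H] X.
rewrite !inE => /or3P[/eqP->|/eqP->|/H//]; exact: pair_edge.
Qed.

Lemma zig_edges z s : path alt z s -> {subset zig z s <= E}.
Proof.
by move=> /zigzag_edges H X; rewrite inE => /orP[/eqP->|/H//]; apply: pair_edge.
Qed.

Lemma zag_edges z s w : path alt z (rcons s w) -> {subset zag z s w <= E}.
Proof.
rewrite rcons_path => /andP[/zig_edges H /andP[elw _]] X.
by rewrite mem_rcons inE => /orP[/eqP->|/H//]; apply: pair_edge.
Qed.

Lemma on_cons z s x : on (z :: s) x = [|| x == z, x == m z | on s x].
Proof.
rewrite /on !inE -(can2_eq mK mK x z).
by case: (x == z); case: (m x == z); case: (x \in s).
Qed.

Lemma on_cat s t x : on (s ++ t) x = on s x || on t x.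
Proof. by rewrite /on !mem_cat orbACA. Qed.

Lemma onm s x : on s (m x) = on s x.
Proof. by rewrite /on mK orbC. Qed.

Lemma zigzag_sub a s X x : X \in zigzag a s -> x \in X -> (x == m a) || on s x.
Proof.
elim: s a => //= z s IH a; rewrite !inE on_cons => /or3P[/eqP->|/eqP->|/IH H /H].
- by rewrite !inE => /orP[]->; rewrite ?orbT.
- by rewrite !inE => /orP[]->; rewrite ?orbT.
- by case/orP=> ->; rewrite ?orbT.
Qed.

Lemma zig_sub z s X x : X \in zig z s -> x \in X -> on (z :: s) x.
Proof.
rewrite inE on_cons => /orP[/eqP->|/zigzag_sub H /H].
  by rewrite !inE => /orP[]->; rewrite ?orbT.
by case/orP=> ->; rewrite ?orbT.
Qed.

Lemma zag_sub z s w X x : X \in zag z s w -> x \in X -> (x == w) || on (z :: s) x.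
Proof.
rewrite mem_rcons inE => /orP[/eqP->|H /(zig_sub H)->]; last by rewrite orbT.
rewrite !inE => /orP[/eqP->|->//].
by rewrite onm /on mem_last orbT.
Qed.

(** This shows that no edge of an ear lies inside the old set [U], so an ear shares no edge with a
    link in [U]. *)
Lemma zigzag_hit a s X : X \in zigzag a s -> exists2 x, x \in X & on s x.
Proof.
elim: s a => //= z s IH a; rewrite !inE => /or3P[/eqP->|/eqP->|/IH[x xX xs]].
- by exists z; rewrite ?on_cons ?inE eqxx ?orbT.
- by exists z; rewrite ?on_cons ?inE eqxx ?orbT.
- by exists x; rewrite ?on_cons ?xs ?orbT.
Qed.

Lemma zag_hit z s w X : X \in zag z s w -> exists2 x, x \in X & on (z :: s) x.
Proof.
rewrite mem_rcons inE => /orP[/eqP->|].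
  by exists (m (last z s)); rewrite ?inE ?eqxx // onm /on mem_last.
rewrite inE => /orP[/eqP->|/zigzag_hit[x xX xs]].
  by exists z; rewrite ?on_cons ?inE eqxx.
by exists x; rewrite ?on_cons ?xs ?orbT.
Qed.

Lemma simple_cons z s : simple (z :: s) = ~~ on s z && simple s.
Proof.
rewrite /simple /on /= !inE negb_or m_neq /=.
have -> : all (fun z0 => m z0 \notin z :: s) s =
          (m z \notin s) && all (fun z0 => m z0 \notin s) s.
  rewrite -has_pred1 -all_predC -all_predI; apply: eq_all => x /=.
  by rewrite inE negb_or (can2_eq mK mK x z).
by case: (z \in s) => //=; case: (m z \in s); rewrite ?andbF.
Qed.

Lemma simple_cat s t : simple (s ++ t) -> 
  [/\ simple s, simple t & forall x, on s x -> ~~ on t x].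
Proof.
elim: s => [|z s IH] //=.
rewrite !simple_cons on_cat negb_or => /andP[/andP[-> zt] /IH[-> -> st]].
split=> // x; rewrite on_cons => /or3P[/eqP->//|/eqP->|/st//].
by rewrite onm.
Qed.

Lemma zig_uniq z s : simple (z :: s) -> uniq (zig z s).
Proof.
elim: s z => [|z' s IH] z //; rewrite simple_cons => /andP[zo s_z'].
have far x (X : {set V}) : ~~ on (z' :: s) x -> x \in X -> X \notin zig z' s.
  by move=> xs xX; apply: contra xs => /zig_sub/(_ xX).
rewrite /zig zigzag_cons 2!cons_uniq IH // andbT inE negb_or -andbA; apply/and3P; split.
- apply/eqP=> /setP/(_ z); rewrite !inE eqxx eq_sym m_neq /=.
  by move: zo; rewrite on_cons; case: (z == z').
- by apply: (far z _ zo); rewrite !inE eqxx.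
- by apply: (far (m z)); rewrite ?onm // !inE eqxx.
Qed.

Lemma zigzag_uniq a s : simple s -> ~~ on s a -> uniq (zigzag a s).
Proof.
case: s => // z s simp as_; rewrite zigzag_cons 1!cons_uniq zig_uniq // andbT.
by apply: contra as_ => /zig_sub H; rewrite -onm H // !inE eqxx.
Qed.

Lemma zag_uniq z s w : simple (z :: s) -> ~~ on (z :: s) w -> uniq (zag z s w).
Proof.
move=> simp ws; rewrite rcons_uniq zig_uniq // andbT.
by apply: contra ws => /zig_sub H; rewrite H // !inE eqxx orbT.
Qed.

(* Unmatched edges added at [a] and at [b] would turn [q] into a closed system
   with at most one defect [d] (see [closed_system]). *)
Definition link (U : {set V}) q d a b :=
  [/\ uniq q, {subset q <= E}, forall X, X \in q -> X \subset U &
      forall v, nN q v + (v == a) + (v == b) = nM q v + 2 * (d == Some v)].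

(* An alternating path from [z], starting with the edge z -- m z, to [u],
   reached by an unmatched edge; [W] holds the new vertices. *)
Definition trail (U W : {set V}) q z u :=
  [/\ uniq q, {subset q <= E},
      forall X, X \in q -> (X \subset U :|: W) && ~~ (X \subset U) &
      forall v, nN q v + (v == z) = nM q v + (v == u)].

Lemma link_sym U q d a b : link U q d a b -> link U q d b a.
Proof. by case=> uq qE qU qn; split=> // v; rewrite addnAC. Qed.

(** Edges of the trail are not contained in [U], hence differ from those of the link; the degree
    conditions add up. *)
Lemma trail_link U W r q d z u b :
  trail U W r z u -> link U q d u b -> link (U :|: W) (r ++ q) d z b.
Proof.
move=> [ur rE rU rn] [uq qE qU qn]; split.
- rewrite cat_uniq ur uq andbT; apply/hasPn=> X /qU XU.
  by apply/negP=> /rU; rewrite XU andbF.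
- by move=> X; rewrite mem_cat => /orP[/rE|/qE].
- move=> X; rewrite mem_cat => /orP[/rU/andP[]//|/qU XU].
  by rewrite (subset_trans XU) ?subsetUl.
- by move=> v; rewrite nN_cat nM_cat; move: (rn v) (qn v); indicator_lia.
Qed.

(* A closed alternating system with at most one vertex [d] where two unmatched
   edges meet: an alternating cycle or a blossom, up to alternating cycles. *)
Definition closed_system q d :=
  [/\ uniq q, {subset q <= E} & forall v, nN q v = nM q v + 2 * (d == Some v)].

Hypothesis closed_weight : forall q d, closed_system q d -> weight q = false.

Definition balanced (U : {set V}) (p : V -> bool) :=
  (forall x, x \in U -> m x \in U) /\
  (forall a b, a \in U -> b \in U ->
     exists q d, link U q d a b /\ weight q = p a (+) p b).

(** * Extending a balanced set by an ear *)

Section Ear.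
Variables (U : {set V}) (p : V -> bool) (a w : V) (zs : seq V).
Hypotheses (Up : balanced U p) (aU : a \in U) (wU : w \in U).
Hypotheses (zsU : forall z, z \in zs -> z \notin U) (zs_simple : simple zs).
Hypothesis zs_path : path alt a (rcons zs w).
Hypothesis zs0 : zs != [::].

Let U' := U :|: [set x | on zs x].
(** The potential is carried along the ear: at a new vertex it is [p (m a)] plus the weight of the
    ear from [m a] to that vertex. For [x] in [zs] the prefix also contains the matched edge at [x],
    which the last summand cancels. *)
Let p' x :=
  let prefix z := take (index z zs).+1 zs in
  if x \in U then p x else
  if x \in zs then p (m a) (+) weight (zigzag a (prefix x)) (+) phi [set x; m x]
  else p (m a) (+) weight (zigzag a (prefix (m x))).

Let mU x : (m x \in U) = (x \in U).
Proof. by apply/idP/idP=> /(proj1 Up); rewrite ?mK. Qed.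

Let onU s x : {subset s <= zs} -> on s x -> x \notin U.
Proof. by move=> szs /orP[|] /szs/zsU; rewrite ?mU. Qed.

Let p'U x : x \in U -> p' x = p x.
Proof. by rewrite /p' => ->. Qed.

Let p'm l z r : zs = l ++ z :: r ->
  p' (m z) = p (m a) (+) weight (zigzag a (rcons l z)).
Proof.
move=> zsE; have zzs : z \in zs by rewrite zsE mem_cat inE eqxx orbT.
rewrite /p' mU (negbTE (zsU zzs)); have [uzs /allP/(_ _ zzs)/negbTE->] := andP zs_simple.
rewrite mK; congr (_ (+) weight (zigzag a _)).
have zl : z \notin l by move: uzs; rewrite zsE cat_uniq /= negb_or => /and3P[_ /andP[]].
by rewrite zsE index_cat (negbTE zl) /= eqxx addn0 -cat_rcons -(size_rcons l z) take_size_cat.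
Qed.

Let p'z l z r : zs = l ++ z :: r -> p' z = p' (m z) (+) phi [set z; m z].
Proof.
move=> zsE; have zzs : z \in zs by rewrite zsE mem_cat inE eqxx orbT.
rewrite /p' mU (negbTE (zsU zzs)); have [uzs /allP/(_ _ zzs)/negbTE->] := andP zs_simple.
by rewrite zzs mK.
Qed.

(** The ear closes a link in [U] from [m a] to [w] to a closed system, and those have weight
    zero. *)
Let ear_weight :
  p (m a) (+) p w = weight (zigzag a zs) (+) phi [set m (last a zs); w].
Proof.
have maU : m a \in U by rewrite mU.
have [q [d [[uq qE qU qn] <-]]] := proj2 Up _ _ maU wU.
have := zs_path; rewrite rcons_path => /andP[zsp /andP[elw wl]].
have ao : ~~ on zs a by apply/negP=> /onU; rewrite aU => /(_ (fun _ => id)).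
suff /closed_weight : closed_system (rcons (zigzag a zs) [set m (last a zs); w] ++ q) d.
  by rewrite weight_cat -cats1 weight_cat weight1; case: (weight q);
     case: (weight (zigzag a zs) (+) _).
split.
- rewrite cat_uniq rcons_uniq zigzag_uniq // uq !andbT; apply/andP; split.
    case: (zs) zs0 zs_simple zsU ao => // z s _ simp sU as_ /=.
    rewrite inE negb_or; apply/andP; split.
      apply/eqP=> /setP/(_ z); rewrite !inE eqxx orbT => /orP[/eqP zl|/eqP zw]; last first.
        by have := sU z; rewrite inE eqxx zw wU => /(_ isT).
      have /andP[_ /allP/(_ (last z s) (mem_last _ _))] := simp.
      by rewrite -zl inE eqxx.
    apply/negP=> /zig_sub H; have := H w; rewrite !inE eqxx orbT => /(_ isT)/orP[].
      by move/sU; rewrite wU.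
    by move/sU; rewrite mU wU.
  apply/hasPn=> X /qU/subsetP XU; rewrite mem_rcons inE negb_or; apply/andP; split.
    apply/eqP=> XE; have := XU (m (last a zs)); rewrite XE !inE eqxx => /(_ isT).
    case: (zs) zs0 zsU => // z s _ /(_ (last z s) (mem_last _ _)) /=.
    by rewrite mU => /negbTE->.
  by apply/negP=> /zigzag_hit[x /XU xU /onU]; rewrite xU => /(_ (fun _ => id)).
- move=> X; rewrite mem_cat mem_rcons inE => /orP[/orP[/eqP->|/zigzag_edges]|/qE//].
    exact: pair_edge.
  exact.
- move=> v; rewrite nN_cat nM_cat -cats1 nN_cat nM_cat.
  rewrite nN_nonmatched ?mK // nM_nonmatched ?mK //.
  by rewrite nN0 nM0; move: (qn v) (degree_zigzag v zsp); indicator_lia.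
Qed.

Let zs_split y : on zs y -> exists l z r, zs = l ++ z :: r /\ (y = z \/ y = m z).
Proof.
case/orP => [yzs|myzs].
  by case/splitPr: yzs => l r; exists l, y, r; split=> //; left.
by case/splitPr: myzs => l r; exists l, (m y), r; split; rewrite ?mK //; right.
Qed.

Let pieces l z r : zs = l ++ z :: r ->
  [/\ path alt a (rcons l z), path alt z (rcons r w), simple (rcons l z),
      simple (z :: r) & forall x, on (rcons l z) x -> ~~ on r x].
Proof.
move=> zsE; move: zs_path zs_simple; rewrite zsE rcons_cat /= -!cat_rcons.
rewrite cat_path last_rcons => /andP[-> ->] /simple_cat[sl sr slr]; split=> //.
by move: zs_simple; rewrite zsE => /simple_cat[].
Qed.

Let onU' l s r x : zs = l ++ s ++ r -> on s x -> x \in U'.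
Proof. by move=> zsE sx; rewrite !inE zsE !on_cat sx !orbT. Qed.

Let on_notU l s r x : zs = l ++ s ++ r -> on s x -> x \notin U.
Proof. by move=> zsE; apply: onU => y ys; rewrite zsE !mem_cat ys orbT. Qed.

Let zs_a : ~~ on zs a.
Proof. by apply/negP=> /onU; rewrite aU => /(_ (fun _ => id)). Qed.

Let prefix_trail l z r : zs = l ++ z :: r ->
  trail U [set x | on (rcons l z) x] (zigzag a (rcons l z)) (m z) (m a).
Proof.
move=> zsE; have [pl _ sl _ _] := pieces zsE; split.
- apply: zigzag_uniq => //; apply: contra zs_a.
  by rewrite zsE -cat_rcons on_cat => ->.
- exact: zigzag_edges.
- move=> X Xz; apply/andP; split.
    apply/subsetP=> x /(zigzag_sub Xz); rewrite !inE => /orP[/eqP->|->].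
      by rewrite mU aU.
    by rewrite orbT.
  have [x xX xl] := zigzag_hit Xz; apply/negP=> /subsetP/(_ x xX).
  by apply/negP; apply: (@on_notU [::] (rcons l z) r); rewrite // zsE cat_rcons.
- by move=> v; have := degree_zigzag v pl; rewrite last_rcons.
Qed.

(** The target is a general [B] because one case of [good_inner] attaches the suffix to [U] enlarged
    by a prefix of the ear. *)
Let suffix_trail (B : {set V}) l z r : zs = l ++ z :: r -> w \in B ->
  (forall x, on (z :: r) x -> x \notin B) ->
  trail B [set x | on (z :: r) x] (zag z r w) z w.
Proof.
move=> zsE wB zrB; have [_ pr _ sr _] := pieces zsE; split.
- by apply: zag_uniq => //; apply: contraL wB => /zrB.
- exact: zag_edges.
- move=> X Xz; apply/andP; split.
    apply/subsetP=> x /(zag_sub Xz); rewrite !inE => /orP[/eqP->|->].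
      by rewrite wB.
    by rewrite orbT.
  have [x xX xl] := zag_hit Xz; apply/negP=> /subsetP/(_ x xX).
  by apply/negP; apply: zrB.
- by move=> v; have := degree_zag v pr.
Qed.

Let good x y := exists q d, link U' q d x y /\ weight q = p' x (+) p' y.

Let good_sym x y : good x y -> good y x.
Proof.
by move=> [q [d [/link_sym l wq]]]; exists q, d; rewrite wq addbC.
Qed.

(** Unmatched edges added at both ends of the empty link meet at [x], so its defect is [x]. *)
Let good_refl x : good x x.
Proof.
exists [::], (Some x); rewrite addbb /weight big_nil; split=> //.
by split=> // v; rewrite nN0 nM0 [Some x == _]eq_sym (inj_eq Some_inj) add0n mul2n -addnn.
Qed.

Let linkW (B C : {set V}) q d x y : B \subset C -> link B q d x y -> link C q d x y.
Proof.
move=> BC [uq qE qB qn]; split=> // X /qB XB; exact: subset_trans BC.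
Qed.

Let weight_zag z s z' : weight (zag z s z') =
  phi [set z; m z] (+) weight (zigzag z s) (+) phi [set m (last z s); z'].
Proof. by rewrite /zag -cats1 weight_cat weight1 weight_cons. Qed.

(** A link must begin with a matched edge: from [m z] one goes back along the ear to [m a], from [z]
    forward to [w], and then on inside [U]. In the forward case [ear_weight] reconciles the
    weights. *)
Let good_outer l z r x : zs = l ++ z :: r -> x \in U -> good (m z) x /\ good z x.
Proof.
move=> zsE xU; have maU : m a \in U by rewrite mU.
split.
  have [q [d [lq wq]]] := proj2 Up _ _ maU xU.
  exists (zigzag a (rcons l z) ++ q), d; split.
    apply: linkW (trail_link (prefix_trail zsE) lq).
    apply/subsetP=> y; rewrite !inE => /orP[->//|yl].
    by rewrite zsE -cat_rcons on_cat yl orbT.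
  by rewrite weight_cat wq (p'm zsE) p'U // addbCA addbA.
have [q [d [lq wq]]] := proj2 Up _ _ wU xU.
exists (zag z r w ++ q), d; split.
  apply: linkW (trail_link (suffix_trail zsE wU _) lq).
    apply/subsetP=> y; rewrite !inE => /orP[->//|yl].
    by rewrite zsE on_cat yl !orbT.
  by move=> y; apply: (@on_notU l (z :: r) [::]); rewrite cats0.
rewrite weight_cat wq weight_zag (p'z zsE) (p'm zsE) (p'U xU).
have := ear_weight; rewrite zsE -cat_rcons zigzag_cat weight_cat.
rewrite last_cat !last_rcons.
move: (weight _) (weight _) (phi _) (phi _) (p (m a)) (p w) (p x).
by do 7!case.
Qed.

Let good_match l z r : zs = l ++ z :: r -> good z (m z).
Proof.
move=> zsE; exists (zig z [::]), None; split.
  split=> //.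
  - by apply: zig_edges.
  - move=> X /zig_sub Xz; apply/subsetP=> x /Xz.
    by apply: (@onU' l [:: z] r).
  - by move=> v; rewrite -degree_zig // addn0.
by rewrite /zig /= weight1 (p'z zsE) addbAC addbb.
Qed.

(** Here [z] precedes [z'] on the ear. The segment between them links [z] to [m z'] without defect,
    [z] to [z'] with defect [z'], and [m z] to [m z'] with defect [m z]. For [m z] and [z'] the
    matched edges point outwards, so the link goes back to [m a], through [U] to [w], and along the
    rest of the ear to [z']. *)
Let good_inner l z s z' r : zs = l ++ z :: s ++ z' :: r ->
  [/\ good z z', good z (m z'), good (m z) (m z') & good (m z) z'].
Proof.
move=> zsE; have zsE' : zs = (l ++ z :: s) ++ z' :: r by rewrite -catA.
have [_ pzs _ szs _] := pieces zsE; have [_ pzr sz' sr disj] := pieces zsE'.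
have pz : path alt z (rcons s z').
  by move: pzs; rewrite rcons_cat /= -cat_rcons cat_path => /andP[].
have sz : simple (z :: rcons s z').
  by move: szs; rewrite -cat_rcons -cat_cons => /simple_cat[].
have sub_on x : on (z :: rcons s z') x -> x \in U'.
  by apply: (@onU' l _ r); rewrite zsE /= cat_rcons.
have w_zzs : weight (zigzag a (rcons (l ++ z :: s) z')) =
    weight (zigzag a (rcons l z)) (+) weight (zigzag z (rcons s z')).
  by rewrite -cat_rcons rcons_cat zigzag_cat last_rcons weight_cat.
have w_zz : weight (zigzag z (rcons s z')) =
    weight (zigzag z s) (+) phi [set m (last z s); z'] (+) phi [set z'; m z'].
  by rewrite -cats1 zigzag_cat weight_cat /= weight_cons weight1 addbA.
split.
- exists (zag z s z'), (Some z'); split; last first.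
    rewrite weight_zag (p'z zsE') (p'z zsE) (p'm zsE') (p'm zsE) w_zzs w_zz.
    move: (weight _) (weight _) (phi _) (phi _) (phi _) (p (m a)).
    by do 6!case.
  split.
  + apply: zag_uniq; first by move: sz; rewrite -rcons_cons -cats1 => /simple_cat[].
    move: sz; rewrite -rcons_cons -cats1 => /simple_cat[_ _ /(_ z')/contraL]; apply.
    by rewrite on_cons eqxx.
  + exact: zag_edges.
  + move=> X /zag_sub Xz; apply/subsetP=> x /Xz xz; apply: sub_on.
    by rewrite -rcons_cons -cats1 on_cat orbC on_cons -orbA; case: (x == z') xz => //= ->; rewrite !orbT.
  + move=> v; rewrite (degree_zag v pz) [Some z' == _]eq_sym (inj_eq Some_inj).
    by rewrite mul2n -addnn addnA.
- exists (zig z (rcons s z')), None; split; last first.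
    rewrite weight_cons (p'z zsE) (p'm zsE') (p'm zsE) w_zzs.
    move: (weight _) (weight _) (phi _) (p (m a)).
    by do 4!case.
  split.
  + exact: zig_uniq.
  + exact: zig_edges.
  + by move=> X /zig_sub Xz; apply/subsetP=> x /Xz /sub_on.
  + by move=> v; rewrite -(degree_zig v pz) last_rcons addn0.
- exists (zigzag z (rcons s z')), (Some (m z)); split; last first.
    rewrite (p'm zsE') (p'm zsE) w_zzs.
    move: (weight _) (weight _) (p (m a)).
    by do 3!case.
  move: (sz); rewrite simple_cons => /andP[zs_z s_s]; split.
  + exact: zigzag_uniq.
  + exact: zigzag_edges.
  + move=> X /zigzag_sub Xz; apply/subsetP=> x /Xz xz; apply: sub_on.
    by rewrite on_cons; case/orP: xz => ->; rewrite ?orbT.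
  + move=> v; rewrite addnAC -[X in _ + X = _]/(nat_of_bool (v == m z)).
    have := degree_zigzag v pz; rewrite last_rcons [Some _ == _]eq_sym (inj_eq Some_inj).
    indicator_lia.
have maU : m a \in U by rewrite mU.
have [q [d [lq wq]]] := proj2 Up _ _ maU wU.
have l1 := link_sym (trail_link (prefix_trail zsE) lq).
have wB : w \in U :|: [set x | on (rcons l z) x] by rewrite inE wU.
apply: good_sym; exists (zag z' r w ++ (zigzag a (rcons l z) ++ q)), d; split.
  apply: linkW (trail_link (suffix_trail zsE' wB _) l1).
    apply/subsetP=> y; rewrite !inE => /orP[/orP[->//|yl]|yl].
      by rewrite zsE -cat_rcons on_cat yl orbT.
    by rewrite zsE' on_cat yl !orbT.
  move=> y yz'; rewrite !inE negb_or; apply/andP; split.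
    by apply: (@on_notU (l ++ z :: s) (z' :: r) [::]); rewrite ?cats0.
  move: zs_simple; rewrite zsE' => /simple_cat[_ _ /(_ y)/contraL/(_ yz')].
  by apply: contra; rewrite -cat_rcons on_cat => ->.
rewrite !weight_cat wq weight_zag (p'z zsE') (p'm zsE') (p'm zsE).
have := ear_weight; rewrite zsE' -cat_rcons zigzag_cat weight_cat w_zzs.
rewrite last_cat !last_rcons.
move: (weight _) (weight _) (weight _) (phi _) (phi _) (p (m a)) (p w).
by do 7!case.
Qed.

Lemma ear_balanced : exists p1, balanced (U :|: [set x | on zs x]) p1.
Proof.
exists p'; split=> [x|]; first by rewrite !inE mU onm.
suff H x y : x \in U' -> y \in U' -> good x y by [].
rewrite !inE => /orP[xU|/zs_split[l [z [r [zsE xz]]]]] /orP[yU|/zs_split[l' [z' [r' [zsE' yz]]]]].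
- have [q [d [lq wq]]] := proj2 Up _ _ xU yU.
  by exists q, d; rewrite !p'U //; split=> //; apply: linkW lq; apply: subsetUl.
- by have [] := good_outer zsE' xU => ? ?; case: yz => ->; apply: good_sym.
- by have [] := good_outer zsE yU => ? ?; case: xz => ->.
have [zz'|nzz'] := eqVneq z z'.
  subst z'; have := good_match zsE => zm; have := good_sym zm => mz.
  by case: xz => ->; case: yz => -> //; apply: good_refl.
have : z' \in zs by rewrite zsE' mem_cat inE eqxx orbT.
rewrite zsE mem_cat inE eq_sym (negbTE nzz') /= => /orP[z'l|z'r].
  move: zsE; case/splitPr: z'l => l1 l2; rewrite -catA => /good_inner[g1 g2 g3 g4].
  by case: xz => ->; case: yz => ->; apply: good_sym.
move: zsE; case/splitPr: z'r => r1 r2 /good_inner[g1 g2 g3 g4].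
by case: xz => ->; case: yz => ->.
Qed.

End Ear.


(** * Existence of ears and growth to the whole graph *)

Hypothesis extendable :
  forall u v, e u v -> exists2 m', perfect_matching e m' & m' u = v.
Hypothesis e_conn : forall x y, connect e x y.

(** Take a perfect matching [m'] through the edge from [u] to [z] and follow [m] and [m']
    alternately from [z] until [U] is reached again. The permutation [rho] makes two such steps at
    once. *)
Lemma ear_exists (U : {set V}) u z :
  (forall x, x \in U -> m x \in U) -> u \in U -> z \notin U -> e u z ->
  exists a w zs, [/\ a \in U /\ w \in U, forall x, x \in zs -> x \notin U,
    simple zs, path alt a (rcons zs w) & zs != [::]].
Proof.
move=> mU uU zU euz; have [m' [m'K em'] m'u] := extendable euz.
pose rho x := m' (m x).
have rho_inj : injective rho by apply: inj_comp; apply: can_inj.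
have m'_neq x : (m' x == x) = false.
  by apply/eqP => m'x; have := em' x; rewrite m'x e_irr.
have rho_a : rho (m u) = z by rewrite /rho mK.
(* The orbit of [z] avoids its image under [m]: such a coincidence could be moved inwards from both
   sides until [m] or [m'] fixes a vertex. *)
have pal d i : m (iter i rho z) <> iter (i + d) rho z.
  have [n] := ubnP d; elim: n d i => // n IH [|[|d]] i; rewrite ltnS => dn.
  - by rewrite addn0 => /eqP; rewrite m_neq.
  - by rewrite addn1 /= => /eqP; rewrite eq_sym /rho m'_neq.
  rewrite addnS iterS => mi; apply: (IH d i.+1); first exact: leq_trans dn.
  by rewrite iterS {1}/rho mi /rho m'K mK addSnnS.
(* As [rho (m u) = z], the last point of the orbit before it returns to [z] is [m u], which lies in
   [U]. *)
have exk : exists k, iter k rho z \in U.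
  exists (order rho z).-1; rewrite -[iter _ _ _]/(finv rho z) -rho_a finv_f //.
  exact: mU.
have [k kU kmin] := ex_minnP exk.
have korder : k <= (order rho z).-1.
  by apply: kmin; rewrite -[iter _ _ _]/(finv rho z) -rho_a finv_f // mU.
exists (m u), (iter k rho z), (traject rho z k); split.
- by rewrite mU.
- move=> _ /trajectP[i ik ->]; apply/negP=> /kmin.
  by rewrite leqNgt ik.
- apply/andP; split.
    rewrite -(@take_traject _ rho (order rho z) k z); last first.
      exact: leq_trans korder (leq_pred _).
    exact/take_uniq/orbit_uniq.
  apply/allP=> _ /trajectP[i _ ->]; apply/negP=> /trajectP[j _ mij].
  have [ij|/ltnW ji] := leqP i j; first by apply: (pal (j - i) i); rewrite subnKC.
  by apply: (pal (i - j) j); rewrite -mij mK subnKC.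
- rewrite -trajectSr -rho_a.
  (* [alt] asks for [rho x != x]; injectivity of [rho] passes this from [m u] to all later
     points. *)
  have : rho (m u) != m u by apply: contraNneq zU => ra; rewrite -rho_a ra mU.
  elim: k.+1 (m u) => //= n IH x rx; rewrite IH ?(inj_eq rho_inj) // andbT.
  by rewrite /alt rx em'.
- by case: k kU {kmin korder} => //=; rewrite (negbTE zU).
Qed.

Lemma balanced_setT U p : balanced U p -> U != set0 -> exists p1, balanced setT p1.
Proof.
have [n] := ubnP #|~: U|; elim: n U p => // n IH U p cU Up /set0Pn[x xU].
have [UT|] := eqVneq U setT; first by exists p; rewrite -UT.
rewrite -subTset => /subsetPn[y _ yU].
have [u [z [uU zU euz]]] : exists u z, [/\ u \in U, z \notin U & e u z].
  have /existsP[u /existsP[z /and3P[? ? ?]]] :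
      [exists u, exists z, [&& u \in U, z \notin U & e u z]]; last by exists u, z.
  apply: contraNT yU => /existsPn noedge.
  have step a b : e a b -> a \in U -> b \in U.
    move=> eab aU; have /existsPn/(_ b) := noedge a.
    by rewrite aU eab andbT negbK.
  have clU : closed e (mem U).
    by move=> a b eab; apply/idP/idP; apply: step; rewrite // e_sym.
  by rewrite -(closed_connect clU (e_conn x y)).
have [a [w [zs [[aU wU] zsU zs_s zs_p zs0]]]] := ear_exists (proj1 Up) uU zU euz.
have [p1 Up1] := ear_balanced Up aU wU zsU zs_s zs_p zs0.
apply: IH Up1 _; last by apply/set0Pn; exists x; rewrite inE xU.
rewrite -ltnS; apply: leq_trans cU; rewrite ltnS; apply: proper_card.
rewrite properE setCS subsetUl /= setCS; apply/subsetPn.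
case: (zs) zs0 zsU => // z1 s _ zsU; exists z1; last by apply: zsU; rewrite inE eqxx.
by rewrite !inE /on inE eqxx !orbT.
Qed.

Lemma balanced_pair x : exists p, balanced [set x; m x] p.
Proof.
exists (fun y => (y == m x) && phi [set x; m x]); split=> [y|].
  by rewrite !inE => /orP[]/eqP->; rewrite ?mK eqxx ?orbT.
have lxx y : link [set x; m x] [::] (Some y) y y.
  by split=> // v; rewrite nN0 nM0 [Some y == _]eq_sym (inj_eq Some_inj) add0n mul2n -addnn.
have lxm : link [set x; m x] [:: [set x; m x]] None x (m x).
  split=> //.
  - by move=> X; rewrite inE => /eqP->; apply: pair_edge.
  - by move=> X; rewrite inE => /eqP->.
  - by move=> v; rewrite nN_matched nM_matched nN0 nM0 !addn0 add0n.
move=> a b; rewrite !inE => /orP[]/eqP-> /orP[]/eqP->.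
- by exists [::], (Some x); rewrite addbb /weight big_nil.
- exists [:: [set x; m x]], None; split=> //.
  by rewrite weight1 eqxx eq_sym m_neq.
- exists [:: [set x; m x]], None; split; first exact: link_sym.
  by rewrite weight1 eqxx eq_sym m_neq addbF.
- by exists [::], (Some (m x)); rewrite addbb /weight big_nil.
Qed.

Lemma nM_le1 q v : uniq q -> nM q v <= 1.
Proof.
move=> uq; apply: leq_trans (_ : count_mem [set v; m v] q <= 1); last first.
  by rewrite count_uniq_mem // leq_b1.
apply: sub_count => X /= /andP[vX /existsP[x /eqP XE]].
move: vX; rewrite XE !inE => /orP[/eqP->//|/eqP->].
by rewrite mK setUC.
Qed.

(** Once the balanced set is everything, an unmatched edge closes a link between its own ends to a
    closed system. *)
Lemma nonmatched_potential : exists p : V -> bool,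
  forall x y, e x y -> y != m x -> phi [set x; y] = p x (+) p y.
Proof.
have [x0|V0] := pickP (mem [set: V]); last by exists xpred0 => x; have := V0 x; rewrite !inE.
have [p0 /balanced_setT[|p [_ plink]]] := balanced_pair x0.
  by apply/set0Pn; exists x0; rewrite !inE eqxx.
exists p => x y exy yx.
have [q [d [[uq qE _ qn] <-]]] := plink x y (in_setT x) (in_setT y).
have xy : x != y by apply: contraTneq exy => ->; rewrite e_irr.
(* If the edge were already in [q], each of its ends would have unmatched degree at least 1 and
   matched degree at most 1, so each would be the defect. *)
have xyq : [set x; y] \notin q.
  apply/negP=> xyq.
  have pos v : v \in [set x; y] -> 0 < nN q v.
    move=> vxy; rewrite -has_count; apply/hasP; exists [set x; y] => //.
    by rewrite vxy matched2.
  have dv v : v \in [set x; y] -> d = Some v.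
    move=> vxy; apply/eqP; move: (qn v) (pos v vxy) (nM_le1 v uq); move: vxy.
    rewrite !inE; case: (d == Some v) => //=.
    by case: (v == x); case: (v == y) => //= _; clear; lia.
  have := dv x; rewrite (dv y) !inE eqxx ?orbT // => /(_ isT)[yx'].
  by rewrite yx' eqxx in xy.
suff /closed_weight : closed_system ([set x; y] :: q) d.
  by rewrite weight_cons; case: (phi _); case: (weight _).
split; first by rewrite /= xyq.
  by move=> X; rewrite inE => /orP[/eqP->|/qE//]; apply: pair_edge.
move=> v; rewrite nN_nonmatched // nM_nonmatched //.
by move: (qn v); indicator_lia.
Qed.

End Alternation.

(** * Near 2-factors of weight zero *)

Lemma incident_edges (V : finType) (e : rel V) (x : V) : symmetric e ->
  [set X in graph_edges e | x \in X] = [set [set x; y] | y in [set y | e x y]].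
Proof.
move=> e_sym; apply/setP=> X; apply/idP/imsetP => [|[y]]; rewrite !inE; last first.
  by move=> exy ->; rewrite !inE eqxx andbT; apply/graph_edgesP; exists x, y.
case/andP=> /graph_edgesP[u [v [euv ->]]]; rewrite !inE => /orP[]/eqP->.
  by exists v; rewrite ?inE.
by exists u; rewrite ?inE 1?e_sym // setUC.
Qed.

Lemma pair_inj (V : finType) (x : V) : injective (fun y => [set x; y]).
Proof.
move=> y z /setP yz; have := yz y; have := yz z; rewrite !inE !eqxx !orbT.
by case: (eqVneq y x) => [->|_] /=; [case: eqP => // -> | move=> _ /esym/eqP].
Qed.

(* Every alternating cycle or blossom can be added (mod 2) to the 2-factor left
   by a perfect matching; if all of these have weight zero, then so has the
   2-factor. *)
Theorem zero_weight_near_2factor (V : finType) (e : rel V) (phi : {set V} -> bool) :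
  symmetric e -> irreflexive e -> (forall x, #|[set y | e x y]| = 3) ->
  (forall D : {set V}, odd #|D| ->
     2 < \sum_(x in D) #|[set y in ~: D | e x y]|) ->
  (forall x y, connect e x y) ->
  exists (Z : {set {set V}}) (d : option V),
  [/\ Z \subset graph_edges e,
      forall x, #|[set X in Z | x \in X]| = if d == Some x then 0 else 2 &
      \big[addb/false]_(X in Z) phi X = false].
Proof.
move=> e_sym e_irr cubic cut3 e_conn.
have [x0 _|V0] := pickP (mem [set: V]); last first.
  exists set0, None; split; rewrite ?sub0set ?big_set0 // => x.
  by have := V0 x; rewrite !inE.
have extendable u v : e u v -> exists2 m, perfect_matching e m & m u = v.
  exact: edge_in_perfect_matching.
have [m pm] : exists m, perfect_matching e m.
  have /card_gt0P[y] : 0 < #|[set y | e x0 y]| by rewrite cubic.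
  by rewrite inE => /extendable[m pm _]; exists m.
have [mK em] := pm.
pose E := graph_edges e; pose C := [set X in E | ~~ matched m X].
have degC x : #|[set X in C | x \in X]| = 2.
  have -> : [set X in C | x \in X] = [set [set x; y] | y in [set y | e x y] :\ m x].
    apply/setP=> X; apply/idP/imsetP => [|[y]]; last first.
      rewrite !inE => /andP[yx exy] ->.
      rewrite !inE eqxx (matched2 e_irr pm) yx !andbT.
      by apply/graph_edgesP; exists x, y.
    rewrite !inE andbAC => /andP[]; have := incident_edges x e_sym.
    move/setP/(_ X); rewrite inE => -> /imsetP[y]; rewrite inE => exy ->.
    by rewrite (matched2 e_irr pm) => yx; exists y; rewrite ?inE ?yx.
  rewrite card_imset; last exact: pair_inj.
  by have := cubic x; rewrite (cardsD1 (m x)) inE em add1n => -[->].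
have [wC|wC] := boolP (\big[addb/false]_(X in C) phi X); last first.
  exists C, None; split=> //; first by apply/subsetP=> X; rewrite inE => /andP[].
  exact: negbTE.
(* Closed systems are recast as edge sets, a finite type over which existence can be decided. *)
pose closed_set (Q : {set {set V}}) d :=
  (Q \subset E) && [forall v, nonmatched_deg m (enum Q) v ==
                              matched_deg m (enum Q) v + 2 * (d == Some v)].
have [/existsP[Q /existsP[d /andP[/andP[QE /forallP Qdeg] wQ]]]|noQ] := boolP
  [exists Q : {set {set V}}, exists d : option V,
    closed_set Q d && weight phi (enum Q)].
  (* This is the sum mod 2 of [Q] and [C]. Its degree at [x] is 2 minus the unmatched plus the
     matched degree of [Q], which is 0 at the defect and 2 elsewhere. *)
  exists [set X in E | (X \in Q) (+) ~~ matched m X], d.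
  split; first by apply/subsetP=> X; rewrite inE => /andP[].
    move=> x; set S := [set X in _ | _].
    have nN : nonmatched_deg m (enum Q) x = #|[set X in C | x \in X] :&: Q|.
      rewrite /nonmatched_deg -sum1_count big_enum_cond sum1dep_card.
      apply: eq_card => X; rewrite !inE; have := subsetP QE X.
      by case: (X \in Q) => [/(_ isT)->|_]; rewrite ?andbT ?andbF //= andbC.
    have nM : matched_deg m (enum Q) x = #|S :&: [set X | matched m X]|.
      rewrite /matched_deg -sum1_count big_enum_cond sum1dep_card.
      apply: eq_card => X; rewrite !inE; have := subsetP QE X.
      case: (X \in Q) => [/(_ isT)->|_]; case: (matched m X) => //=;
        by rewrite ?andbT ?andbF.
    have rest : #|S :\: [set X | matched m X]| = #|[set X in C | x \in X] :\: Q|.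
      apply: eq_card => X; rewrite !inE.
      by case: (X \in Q); case: (matched m X); rewrite ?andbF ?andbT.
    have := cardsID [set X | matched m X] S; have := cardsID Q [set X in C | x \in X].
    rewrite degC rest -nN -nM; move/eqP: (Qdeg x) => ->.
    move: (matched_deg _ _ _) #|_ :\: Q| #|S| => i j k.
    by case: (d == Some x); rewrite ?muln1 ?muln0; clear; lia.
  have -> : \big[addb/false]_(X in [set X in E | (X \in Q) (+) ~~ matched m X]) phi X =
            \big[addb/false]_(X in Q) phi X (+) \big[addb/false]_(X in C) phi X.
    rewrite big_mkcond [in RHS]big_mkcond [X in _ (+) X]big_mkcond -big_split /=.
    apply: eq_bigr => X _; rewrite !inE; have := subsetP QE X.
    case: (X \in Q) => [/(_ isT)->|_]; case: (matched m X); rewrite ?andbT ?andbF //=;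
      by case: (phi X).
  by rewrite wC; move: wQ; rewrite /weight big_enum => ->.
have closed_weight q d : closed_system e m q d -> weight phi q = false.
  move=> [uq qE qn].
  have pq : perm_eq (enum [set X in q]) q.
    by apply: uniq_perm; rewrite ?enum_uniq // => X; rewrite mem_enum inE.
  move: noQ; rewrite negb_exists => /forallP/(_ [set X in q]).
  rewrite negb_exists => /forallP/(_ d); rewrite negb_and.
  rewrite {1}/weight (perm_big _ pq) => /orP[|/negbTE//] /negP[]; apply/andP; split.
    by apply/subsetP=> X; rewrite inE => /qE.
  apply/forallP=> v; rewrite /nonmatched_deg /matched_deg !(permP pq).
  by rewrite -/(nonmatched_deg m q v) qn.
have [p phip] := nonmatched_potential e_sym e_irr pm closed_weight extendable e_conn.
(* On [C] the weight is the coboundary of [p]; each vertex has degree 2 in [C], so its value is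
   counted twice. *)
exfalso; move/negP: wC; apply.
have -> : \big[addb/false]_(X in C) phi X =
          \big[addb/false]_(X in C) \big[addb/false]_(x in X) p x.
  apply: eq_bigr => X; rewrite inE => /andP[/graph_edgesP[x [y [exy ->]]]].
  rewrite (matched2 e_irr pm) => yx; rewrite phip // big_setU1 /= ?big_set1 //.
  by rewrite inE; apply: contraTneq exy => ->; rewrite e_irr.
rewrite (exchange_big_dep predT) //= big1 // => x _.
rewrite big_const (_ : #|_| = 2) /= ?addbF ?addbb // -(degC x).
by apply: eq_card => X; rewrite [RHS]inE.
Qed.

(** * Mod 2 linear algebra and the dual graph *)

Lemma odd_sum (I : finType) (A : {pred I}) (n : I -> nat) :
  odd (\sum_(i in A) n i) = odd #|[set i in A | odd (n i)]|.
Proof.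
rewrite (big_morph odd oddD (erefl _)) cardsE -sum1_card (big_morph odd oddD (erefl _)).
rewrite big_mkcond [RHS]big_mkcond; apply: eq_bigr => i _.
by rewrite [in RHS]unfold_in; case: (i \in A); case: (odd (n i)).
Qed.

Section LinearAlgebra.
Import GRing.Theory.
Local Open Scope ring_scope.

Lemma sum_bool (I : finType) (P b : pred I) :
  \sum_(i | P i) b i = odd #|[set i | P i && b i]|.
Proof.
rewrite cardsE -sum1_card (big_morph odd oddD (erefl _)).
rewrite big_mkcond [RHS]big_mkcond; apply: eq_bigr => i _.
by rewrite unfold_in; case: (P i); case: (b i).
Qed.

(** The left kernel lies in the line spanned by the all-ones vector. *)
Lemma rank_const_ker (K : fieldType) n q (A : 'M[K]_(n, q)) :
  (forall u : 'rV_n, u *m A = 0 -> forall i j, u 0 i = u 0 j) ->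
  (n <= \rank A + 1)%N.
Proof.
move=> constA; have : (kermx A <= (const_mx 1 : 'rV_n))%MS.
  apply/row_subP=> i; have : row i (kermx A) *m A = 0.
    by rewrite -row_mul mulmx_ker row0.
  move/constA=> ci; apply/sub_rVP; exists (row i (kermx A) 0 i).
  by apply/rowP=> j; rewrite [RHS]mxE [X in _ * X]mxE mulr1.
move/mxrankS; rewrite mxrank_ker => /leq_trans/(_ (rank_leq_row _)).
by rewrite leq_subLR.
Qed.

(** The row space of [B] has codimension at most 1 in the left kernel of [D]. If it is proper, [w]
    is a functional killing [B] but not some [z0] in that kernel. A [z] outside [B] but killed by
    [D] and [w] would span the kernel together with [B], so [w] would kill [z0] too. *)
Lemma ker_mod_row_functional (K : fieldType) p n q (B : 'M[K]_(p, n)) (D : 'M[K]_(n, q)) :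
  B *m D = 0 -> (n <= \rank B + \rank D + 1)%N ->
  exists w : 'cV[K]_n, forall z : 'rV[K]_n, z *m D = 0 -> z *m w = 0 -> (z <= B)%MS.
Proof.
move=> BD rk; have [kerB|/row_subPn[i zB]] := boolP (kermx D <= B)%MS.
  by exists 0 => z /sub_kermxP zD _; apply: submx_trans kerB.
set z0 := row i _ in zB.
have z0D : (z0 <= kermx D)%MS by apply: row_sub.
have [k zk] : exists k, (z0 *m cokermx B) 0 k != 0.
  apply/existsP; apply: contraNT zB => /existsPn zB; rewrite submxE; apply/eqP/rowP=> k.
  by have := zB k; rewrite negbK => /eqP->; rewrite mxE.
exists (col k (cokermx B)) => z zD zw.
have mul_col r (A : 'M_(r, n)) : A *m col k (cokermx B) = col k (A *m cokermx B).
  by rewrite !colE mulmxA.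
have Bw : B *m col k (cokermx B) = 0 by rewrite mul_col mulmx_coker colE mul0mx.
apply: contraNT zk => zB'.
have sub : (B + z <= kermx D)%MS.
  by rewrite addsmx_sub !sub_kermx BD zD !eqxx.
have : (kermx D <= B + z)%MS.
  have [_ /esym eqr] := mxrank_leqif_sup sub; rewrite eqr eqn_leq (mxrankS sub) mxrank_ker.
  have /andP[_] : (B <= B + z)%MS && (\rank B < \rank (B + z)%MS)%N.
    by rewrite -ltmxErank ltmxE addsmxSl addsmx_sub submx_refl.
  by lia.
move/(submx_trans z0D)/sub_addsmxP=> [[u1 u2] /= ->].
have : (u1 *m B + u2 *m z) *m col k (cokermx B) = 0.
  by rewrite mulmxDl -!mulmxA Bw zw !mulmx0 addr0.
by rewrite mul_col => /rowP/(_ 0); rewrite mxE [RHS]mxE => ->.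
Qed.

End LinearAlgebra.

(** * The dual cubic graph *)

Section Dual.
Variables (T : finType) (F : {set {set T}}).
Hypothesis F3 : forall f, f \in F -> #|f| = 3.
Hypothesis tri_edge_faces : forall s, s \in tri_edges F -> #|[set f in F | s \subset f]| = 2.

Definition face := {f : {set T} | f \in F}.
Definition dual_adj : rel face := fun f g => #|val f :&: val g| == 2.
Definition dual_edge (s : {set T}) : {set face} := [set f : face | s \subset val f].

Lemma card_face (f : face) : #|val f| = 3.
Proof. exact/F3/valP. Qed.

Lemma card_dual_edge s : s \in tri_edges F -> #|dual_edge s| = 2.
Proof.
move=> /tri_edge_faces <-; rewrite -(card_imset _ val_inj).
apply: eq_card => f; rewrite !inE; apply/imsetP/andP => [[g + ->]|[fF sf]].
  by rewrite inE => sg; split=> //; apply: valP.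
by exists (Sub f fF : face); rewrite ?inE.
Qed.

Lemma face_sub_eq (f g : face) : val f \subset val g -> f = g.
Proof. by move=> fg; apply/val_inj/eqP; rewrite eqEcard fg !card_face. Qed.

Lemma tri_edgesE (s : {set T}) (f : face) : s \subset val f -> (s \in tri_edges F) = (#|s| == 2).
Proof.
move=> sf; rewrite inE; case: (_ == 2) => //=; apply/exists_inP.
by exists (val f) => //; apply: (valP f).
Qed.

Lemma dual_adj_sym : symmetric dual_adj.
Proof. by move=> f g; rewrite /dual_adj setIC. Qed.

Lemma dual_adj_irr : irreflexive dual_adj.
Proof. by move=> f; rewrite /dual_adj setIid card_face. Qed.

Lemma dual_adj_edge f g : dual_adj f g ->
  (val f :&: val g \in tri_edges F) /\ dual_edge (val f :&: val g) = [set f; g].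
Proof.
move=> fg; have sE : val f :&: val g \in tri_edges F.
  by rewrite (@tri_edgesE _ f) ?subsetIl.
split=> //; apply/esym/eqP; rewrite eqEcard card_dual_edge // cards2 subUset !sub1set.
rewrite !inE subsetIl subsetIr /=.
by case: eqVneq fg => // ->; rewrite dual_adj_irr.
Qed.

Lemma dual_edge_adj (s : {set T}) (f : face) : s \in tri_edges F -> s \subset val f ->
  exists g, [/\ dual_adj f g, val f :&: val g = s & dual_edge s = [set f; g]].
Proof.
move=> sE sf; have /eqP/cards2P[f1 [f2 [f12 E12]]] := card_dual_edge sE.
have [g [fg Eg]] : exists g, f != g /\ dual_edge s = [set f; g].
  have : f \in dual_edge s by rewrite inE.
  rewrite E12 !inE => /orP[]/eqP->; first by exists f2.
  by exists f1; rewrite eq_sym setUC.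
have sg : s \subset val g.
  by have : g \in dual_edge s; [rewrite Eg !inE eqxx orbT | rewrite inE].
have s2 : #|s| = 2 by move: sE; rewrite inE => /andP[/eqP].
have sI : s \subset val f :&: val g by rewrite subsetI sf.
have c2 : #|val f :&: val g| = 2.
  apply/eqP; rewrite eqn_leq -{2}s2 subset_leq_card // andbT -ltnS -(card_face f).
  apply: proper_card; rewrite properE subsetIl subsetI subxx /=.
  by apply: contra fg => /face_sub_eq ->.
exists g; split=> //; first by rewrite /dual_adj c2.
by apply/esym/eqP; rewrite eqEcard sI c2 s2.
Qed.

(** An edge is recovered as the intersection of the two faces that contain it. *)
Lemma dual_edge_inj : {in tri_edges F &, injective dual_edge}.
Proof.
move=> s t sE tE st.
have /card_gt0P[f] : 0 < #|dual_edge s| by rewrite card_dual_edge.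
move=> fs; have ft : f \in dual_edge t by rewrite -st.
rewrite inE in fs; rewrite inE in ft.
have [g [_ Is Es]] := dual_edge_adj sE fs; have [g' [_ It Et]] := dual_edge_adj tE ft.
have /pair_inj gg' : [set f; g] = [set f; g'] by rewrite -Es -Et st.
by rewrite -Is -It gg'.
Qed.

Lemma card_edges_face (f : face) : #|[set s in tri_edges F | s \subset val f]| = 3.
Proof.
have <- : 'C(#|val f|, 2) = 3 by rewrite card_face.
rewrite -cards_draws; apply: eq_card => s; rewrite !inE [LHS]andbC.
by case sf: (s \subset val f) => //=; have := tri_edgesE sf; rewrite inE.
Qed.

(** The number is 2 if [x] lies on [f] and 0 otherwise: the boundary of a face is a cycle mod 2. *)
Lemma even_edges_face x (f : face) :
  ~~ odd #|[set s in tri_edges F | (x \in s) && (s \subset val f)]|.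
Proof.
have [xf|xf] := boolP (x \in val f); last first.
  rewrite (_ : [set s in _ | _] = set0) ?cards0 //; apply/setP=> s; rewrite !inE.
  by apply: contraNF xf => /and3P[_ xs /subsetP->].
suff -> : [set s in tri_edges F | (x \in s) && (s \subset val f)] =
    [set [set x; y] | y in val f :\ x].
  rewrite card_imset; last exact: pair_inj.
  by have := card_face f; rewrite (cardsD1 x) xf add1n => -[->].
apply/setP=> s; apply/idP/imsetP => [|[y]].
  rewrite inE => /and3P[sE xs sf].
  have : #|s| = 2 by move: sE; rewrite inE => /andP[/eqP].
  rewrite (cardsD1 x) xs => -[/eqP/cards1P[y Ey]].
  have : y \in s :\ x by rewrite Ey inE.
  rewrite !inE => /andP[yx ys]; exists y; rewrite ?inE ?yx ?(subsetP sf) //.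
  by rewrite -(setD1K xs) Ey.
move=> /setD1P[yx yf] ->.
have sf : [set x; y] \subset val f by rewrite subUset !sub1set xf.
by apply/setIdP; rewrite (tri_edgesE sf) cards2 [x == y]eq_sym yx sf set21.
Qed.

Lemma dual_cubic f : #|[set g | dual_adj f g]| = 3.
Proof.
rewrite -(card_edges_face f) -(@card_in_imset _ _ (fun g => val f :&: val g)).
  apply: eq_card => s; apply/imsetP/idP => [[g]|].
    by rewrite inE => fg ->; rewrite inE subsetIl andbT; have [] := dual_adj_edge fg.
  rewrite inE => /andP[sE sf]; have [g [fg Es _]] := dual_edge_adj sE sf.
  by exists g; rewrite ?inE ?Es.
move=> g g'; rewrite !inE => /dual_adj_edge[_ Eg] /dual_adj_edge[_ Eg'] gg'.
by apply: (@pair_inj _ f); rewrite /= -Eg -Eg' gg'.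
Qed.

(* [b] is the boundary of [D]: a mod 2 cycle of the simple primal graph, of the
   parity of [D], hence not a single edge. *)
Lemma dual_cut3 (D : {set face}) : odd #|D| ->
  2 < \sum_(f in D) #|[set g in ~: D | dual_adj f g]|.
Proof.
move=> oD; pose b := [set s in tri_edges F | odd #|dual_edge s :&: D|].
have exch (P : pred {set T}) :
    \sum_(f in D) #|[set s in tri_edges F | P s && (s \subset val f)]| =
    \sum_(s in [set s in tri_edges F | P s]) #|dual_edge s :&: D|.
  under eq_bigr => f _ do rewrite -sum1dep_card.
  rewrite (exchange_big_dep (mem [set s in tri_edges F | P s])) /=.
    apply: eq_bigr => s; rewrite inE => /andP[sE Ps]; rewrite sum1dep_card.
    by apply: eq_card => f; rewrite !inE; move: sE; rewrite inE => ->; rewrite Ps andbC.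
  by move=> f s _ /and3P[sE Ps _]; rewrite inE sE.
have ob : odd #|b|.
  have := exch xpredT; rewrite (eq_bigr (fun _ => 3)) => [|f _]; last exact: card_edges_face.
  rewrite sum_nat_const => /(congr1 odd); rewrite oddM oD odd_sum /= => /esym oE.
  by apply: etrans oE; congr odd; apply: eq_card => s; rewrite !inE andbT.
(* Otherwise an end [x] of the only edge would have degree 1 in [b], whereas every face contributes
   an even number of edges at [x]. *)
have b1 : #|b| != 1.
  apply/negP=> /cards1P[s bs]; have : s \in b by rewrite bs inE.
  rewrite inE => /andP[sE _].
  have /card_gt0P[x xs] : 0 < #|s| by move: sE; rewrite inE => /andP[/eqP->].
  have := exch (fun s : {set T} => x \in s); move/(congr1 odd); rewrite !odd_sum.
  rewrite (_ : [set f in D | _] = set0) ?cards0 /=; last first.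
    by apply/setP=> f; rewrite !inE (negbTE (even_edges_face x f)) andbF.
  suff -> : #|[set s0 in [set s0 in tri_edges F | x \in s0] | odd #|dual_edge s0 :&: D|]| = 1 by [].
  rewrite -(cards1 s) -bs; apply: eq_card => t.
  apply/setIdP/setIdP => [[/setIdP[tE _] ot]|[tE ot]]; first by split.
  have : t \in b by apply/setIdP.
  by rewrite bs => /set1P ts; split=> //; apply/setIdP; rewrite ts.
have : #|b| <= \sum_(f in D) #|[set g in ~: D | dual_adj f g]|.
  apply: (@leq_trans (\sum_(s in [set s in tri_edges F | s \in b]) #|dual_edge s :&: D|)).
    have -> : [set s in tri_edges F | s \in b] = b.
      by apply/setP=> s; rewrite !inE; case: (_ && [exists f in _, _]).
    rewrite -sum1_card; apply: leq_sum => s; rewrite inE => /andP[_]; exact: odd_gt0.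
  rewrite -exch; apply: leq_sum => f fD.
  rewrite -[leqRHS](card_imset _ (@pair_inj _ f)).
  rewrite -(card_in_imset (f := dual_edge)); last first.
    by move=> s t; rewrite !inE => /andP[sE _] /andP[tE _]; apply: dual_edge_inj; rewrite inE.
  apply: subset_leq_card; apply/subsetP=> _ /imsetP[s + ->].
  rewrite inE => /and3P[sE]; rewrite inE => /andP[_ os] sf.
  have [g [fg _ Es]] := dual_edge_adj sE sf.
  rewrite Es in os *; apply/imsetP; exists g => //; rewrite !inE fg andbT.
  apply: contraTN os => gD; rewrite (setIidPl _) ?subUset ?sub1set ?fD //.
  by rewrite cards2; case: eqVneq fg => // ->; rewrite dual_adj_irr.
by apply: leq_trans; move: ob b1; case: #|b| => [|[|[|]]].
Qed.

End Dual.

(** * Triangulations of the projective plane *)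

Section Triangulation.
Variables (T : finType) (F : {set {set T}}).
Hypothesis triF : is_projplane_triangulation F.

Let F3 : forall f, f \in F -> #|f| = 3. Proof. by case: triF. Qed.
Let edge2 s : s \in tri_edges F -> #|[set f in F | s \subset f]| = 2.
Proof. by case: triF => _ [_ [+ _]]; apply. Qed.
Let link_conn v a b : tri_adj F v a -> tri_adj F v b -> connect (tri_link F v) a b.
Proof. by case: triF => _ [_ [_ [+ _]]]; apply. Qed.
Let T_conn x y : connect (tri_adj F) x y.
Proof. by case: triF => _ [_ [_ [_ [+ _]]]]; apply. Qed.
Let euler : #|T| + #|F| = #|tri_edges F| + 1.
Proof. by case: triF => _ [_ [_ [_ [_ +]]]]. Qed.

Local Notation face := (face F).
Local Notation E := (tri_edges F).

Lemma connect_common_pair x y (f g : face) : x != y ->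
  x \in val f -> y \in val f -> x \in val g -> y \in val g ->
  connect (@dual_adj _ F) f g.
Proof.
move=> xy xf yf xg yg; have [->//|fg] := eqVneq f g.
have sf : [set x; y] \subset val f by rewrite subUset !sub1set xf.
have sE : [set x; y] \in E by rewrite (tri_edgesE sf) cards2 xy.
have [h [fh _ Eh]] := dual_edge_adj F3 edge2 sE sf.
have : g \in dual_edge F [set x; y] by rewrite inE subUset !sub1set xg.
by rewrite Eh !inE eq_sym (negbTE fg) => /eqP->; apply: connect1.
Qed.

Lemma face_other (f : face) x : exists2 y, y != x & y \in val f.
Proof.
have : 0 < #|val f :\ x|.
  by have := card_face F3 f; rewrite (cardsD1 x); case: (x \in _); case: #|_|.
by case/card_gt0P=> y /setD1P[yx yf]; exists y.
Qed.

(** A walk in the link of [v] traverses faces around [v], consecutive ones sharing an edge at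
    [v]. *)
Lemma connect_common_vertex v (f g : face) : v \in val f -> v \in val g ->
  connect (@dual_adj _ F) f g.
Proof.
move=> vf vg; have [a av af] := face_other f v; have [b bv bg] := face_other g v.
have adjv c (h : face) : c != v -> v \in val h -> c \in val h -> tri_adj F v c.
  move=> cv vh ch; rewrite /tri_adj eq_sym cv /=; apply/exists_inP.
  by exists (val h); [exact: valP | rewrite vh].
have /connectP[p] := link_conn (adjv _ _ av vf af) (adjv _ _ bv vg bg).
elim: p a f av af vf => [|a' p IH] a f av af vf /=.
  by move=> _ ba; apply: (@connect_common_pair v a); rewrite // 1?eq_sym // -ba.
case/andP=> /and4P[_ a'v aa' hF] pp blast.
apply: (@connect_trans _ _ (Sub [set v; a; a'] hF : face)).
  by apply: (@connect_common_pair v a); rewrite ?SubK ?inE ?eqxx ?orbT // eq_sym.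
by apply: IH pp blast; rewrite ?SubK ?inE ?eqxx ?orbT.
Qed.

(** Along a path of the triangulation, consecutive vertices share a face, and the faces at one
    vertex are connected in the dual. *)
Lemma dual_connected (f g : face) : connect (@dual_adj _ F) f g.
Proof.
have [x xf] : exists x, x \in val f by apply/set0Pn; rewrite -card_gt0 (card_face F3).
have [y yg] : exists y, y \in val g by apply/set0Pn; rewrite -card_gt0 (card_face F3).
have /connectP[p] := T_conn x y.
elim: p x f xf => [|x' p IH] x f xf /=.
  by move=> _ yx; apply: (@connect_common_vertex x); rewrite // -yx.
case/andP=> /andP[_ /exists_inP[h hF /andP[xh x'h]]] pp ylast.
apply: (@connect_trans _ _ (Sub h hF : face)).
  by apply: (@connect_common_vertex x); rewrite ?SubK.
by apply: IH pp ylast; rewrite SubK.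
Qed.

(** * Incidence matrices and mod 2 homology *)

Section Incidence.
Import GRing.Theory.
Local Open Scope ring_scope.

(* The boolean field [bool] plays the role of F_2. *)
Definition vertex_edge : 'M[bool]_(#|T|, #|E|) :=
  \matrix_(i, j) ((enum_val i : T) \in (enum_val j : {set T})).
Definition edge_face : 'M[bool]_(#|E|, #|{: face}|) :=
  \matrix_(j, k) ((enum_val j : {set T}) \subset val (enum_val k : face)).

Lemma sum_edges (P : pred {set T}) :
  \sum_(j < #|E|) (P (enum_val j) : bool) = odd #|[set s in E | P s]| :> bool.
Proof. by rewrite -(sum_bool (mem E) P) [RHS]big_enum_val. Qed.

Lemma vertex_edge_face : vertex_edge *m edge_face = 0.
Proof.
apply/matrixP=> i k; rewrite !mxE.
under eq_bigr => j _ do rewrite !mxE.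
rewrite (sum_edges (fun s => (enum_val i \in s) && (s \subset val (enum_val k : face)))).
exact/negbTE/(even_edges_face F3).
Qed.

Lemma sum_pair_bool (I : finType) (u : I -> bool) (P : pred I) a b :
  a != b -> (forall i, P i = (i \in [set a; b])) ->
  \sum_i (u i * P i) = u a + u b.
Proof.
move=> ab Pab; rewrite (eq_bigr (fun i => if i \in [set a; b] then u i else 0)).
  by rewrite -big_mkcond big_setU1 ?inE //= big_set1.
by move=> i _; rewrite Pab; case: ifP => _; rewrite ?mulr1 ?mulr0.
Qed.

Lemma mul_vertex_edge (u : 'rV[bool]_#|T|) j a b : a != b ->
  enum_val j = [set a; b] ->
  (u *m vertex_edge) 0 j = u 0 (enum_rank a) + u 0 (enum_rank b).
Proof.
move=> ab Ej; rewrite mxE (reindex (@enum_rank T)) /=; last exact/onW_bij/enum_rank_bij.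
rewrite -(sum_pair_bool (fun x => u 0 (enum_rank x)) ab (fun _ => erefl)).
by apply: eq_bigr => x _; rewrite mxE enum_rankK Ej.
Qed.

Lemma tri_edge_rank s : s \in E -> exists j : 'I_#|E|, enum_val j = s.
Proof. by move=> sE; exists (enum_rank_in sE s); rewrite enum_rankK_in. Qed.

Lemma rank_vertex_edge : (#|T| <= \rank vertex_edge + 1)%N.
Proof.
apply: rank_const_ker => u uB i j; rewrite -(enum_valK i) -(enum_valK j).
have /connectP[p] := T_conn (enum_val i) (enum_val j).
elim: p (enum_val i) => [|y p IH] x /=; first by move=> _ ->.
case/andP=> /andP[xy /exists_inP[f fF /andP[xf yf]]] pp jlast; rewrite -(IH y pp jlast).
have sE : [set x; y] \in E.
  by rewrite (@tri_edgesE _ _ _ (Sub f fF : face)) ?cards2 ?xy // SubK subUset !sub1set xf.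
have [k Ek] := tri_edge_rank sE; have := mul_vertex_edge u xy Ek.
by rewrite uB mxE; case: (u 0 _); case: (u 0 _).
Qed.

(** A vector in the left kernel of the transpose agrees on the two faces at each edge, so it is
    constant because the dual is connected. *)
Lemma rank_edge_face : (#|F| <= \rank edge_face + 1)%N.
Proof.
rewrite -(card_sig (mem F)) -mxrank_tr.
apply: rank_const_ker => u uD i j; rewrite -(enum_valK i) -(enum_valK j).
have /connectP[p] := dual_connected (enum_val i) (enum_val j).
elim: p (enum_val i) => [|g p IH] f /=; first by move=> _ ->.
case/andP=> fg pp jlast; rewrite -(IH g pp jlast).
have [sE Es] := dual_adj_edge F3 edge2 fg; have [k Ek] := tri_edge_rank sE.
have neq : f != g by apply: contraTneq fg => ->; rewrite (dual_adj_irr F3).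
have : (u *m edge_face^T) 0 k = u 0 (enum_rank f) + u 0 (enum_rank g).
  rewrite mxE (reindex (@enum_rank face)) /=; last exact/onW_bij/enum_rank_bij.
  rewrite -(sum_pair_bool (fun x => u 0 (enum_rank x)) neq (fun _ => erefl)).
  by apply: eq_bigr => h _; rewrite !mxE enum_rankK -Es inE Ek.
by rewrite uD mxE; case: (u 0 _); case: (u 0 _).
Qed.

End Incidence.

Import GRing.Theory.

Lemma exists_weak_or_near_weak :
  exists c : T -> bool, weak_coloring F c \/ near_weak_coloring F c.
Proof.
(* By Euler's formula the two rank bounds add up to all edges but one, so a single functional [w]
   detects whether a cycle is null-homologous. *)
have [|w null] := ker_mod_row_functional vertex_edge_face.
  by have := rank_vertex_edge; have := rank_edge_face; have := euler; lia.
(* Since [dual_edge] is injective on edges, the sum has at most one term: [phi] carries [w] over to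
   the dual edges. *)
pose phi (X : {set face}) : bool :=
  (\sum_(j < #|E| | dual_edge F (enum_val j) == X) w j 0)%R.
have [Z [d [ZE Zdeg Zphi]]] := zero_weight_near_2factor phi (@dual_adj_sym _ F)
  (dual_adj_irr F3) (dual_cubic F3 edge2) (dual_cut3 F3 edge2) dual_connected.
pose z : 'rV[bool]_#|E| := (\row_j (dual_edge F (enum_val j) \in Z))%R.
have degZ (f : face) : #|[set s in E | (dual_edge F s \in Z) && (s \subset val f)]| =
    (if d == Some f then 0 else 2).
  rewrite -Zdeg -(card_in_imset (f := dual_edge F)); last first.
    by move=> s t /setIdP[sE _] /setIdP[tE _]; apply: dual_edge_inj sE tE.
  apply: eq_card => X; apply/imsetP/setIdP => [[s /setIdP[sE /andP[sZ sf]] ->]|[XZ fX]].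
    by rewrite inE.
  have /graph_edgesP[g [h [gh EX]]] := subsetP ZE X XZ.
  have [sE Es] := dual_adj_edge F3 edge2 gh.
  exists (val g :&: val h); last by rewrite Es.
  apply/setIdP; split=> //; rewrite Es -EX XZ /=.
  by move: fX; rewrite EX -Es inE.
have zD : (z *m edge_face = 0)%R.
  apply/rowP=> k; rewrite !mxE; under eq_bigr => j _ do rewrite !mxE.
  rewrite (sum_edges (fun s => (dual_edge F s \in Z) && (s \subset val (enum_val k : face)))).
  by rewrite degZ; case: ifP.
have zw : (z *m w = 0)%R.
  apply/matrixP=> i k; rewrite !ord1 !mxE -[RHS]Zphi /phi.
  rewrite (exchange_big_dep predT) //=; apply: eq_bigr => j _; rewrite mxE.
  have [deZ|deZ] := boolP (_ \in Z); last first.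
    rewrite mul0r big_pred0 // => X; apply/negbTE; apply: contra deZ.
    by case/andP=> XZ /eqP->.
  rewrite mul1r (big_pred1 (dual_edge F (enum_val j))) // => X /=.
  by rewrite [RHS]eq_sym; case: eqP => [<-|]; rewrite ?deZ ?andbF.
(* Writing [z] as [u *m vertex_edge] makes [u] a coloring whose bichromatic edges are exactly those
   whose dual edges lie in [Z]. *)
have /submxP[u zu] := null z zD zw.
pose c x := u 0%R (enum_rank x); exists c.
(* A monochromatic face has no bichromatic edge, so it has degree 0 in [Z] and must be the missed
   vertex of the dual. *)
have mono_d (f : face) : monochromatic c (val f) -> d = Some f.
  move=> /forallP mono; apply/eqP; have := degZ f; case: (d == Some f) => // deg2.
  have /card_gt0P[s] : 0 < #|[set s in E | (dual_edge F s \in Z) && (s \subset val f)]|.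
    by rewrite deg2.
  case/setIdP=> sE /andP[sZ sf]; have [j Ej] := tri_edge_rank sE.
  have /cards2P[a [b [ab sab]]] : #|s| == 2 by rewrite -(tri_edgesE sf).
  have := mul_vertex_edge u ab (etrans Ej sab); rewrite -zu mxE Ej sZ.
  have af : a \in val f by rewrite (subsetP sf) // sab set21.
  have bf : b \in val f by rewrite (subsetP sf) // sab set22.
  have := mono a; rewrite af => /forallP/(_ b); rewrite bf /c => /eqP->.
  by case: (u 0%R _).
have : n_mono F c <= 1.
  apply/card_le1_eqP=> f g /setIdP[fF fc] /setIdP[gF gc].
  have := mono_d (Sub g gF); rewrite SubK (mono_d (Sub f fF)) ?SubK // => /(_ gc).
  by case.
by rewrite /weak_coloring /near_weak_coloring; case: n_mono => [|[|]] // _; [left|right].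
Qed.

End Triangulation.

Theorem theorem2p2 (T : finType) (F : {set {set T}}) :
  is_projplane_triangulation F ->
  exists c : T -> bool, weak_coloring F c \/ near_weak_coloring F c.
Proof. exact: exists_weak_or_near_weak. Qed.
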